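(* Every triangulation $G$ of the projective plane has a bipartite subgraph $H$ with $|E(H)|\ge \frac{2}{3}|E(G)|-1$.
   Context: A triangulation of a surface is a graph without loops or multiple edges, 2-cell embedded on the surface such that every face is bounded by a closed walk of length 3. *)

(* Defs.v *)
From mathcomp Require Import all_boot.
Set Implicit Arguments. Unset Strict Implicit. Unset Printing Implicit Defensive.

(* A finite simple graph on vertex set T is a symmetric irreflexive relation e.
   A triangulation of a closed surface is given combinatorially by the graph
   together with its set of (triangular) faces F, each face recorded by its
   set of three vertices. *)

Section Tri.
Variable T : finType.

Definition simple_graph (e : rel T) : Prop :=
  irreflexive e /\ symmetric e.

Definition edges (e : rel T) : {set {set T}} :=
  [set s : {set T} | [exists x, exists y, e x y && (s == [set x; y])]].

Definition link (F : {set {set T}}) (v : T) : rel T :=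
  fun u w => [set v; u; w] \in F.

(* (e, F) is a triangulation of a closed connected surface:
   - faces are triangles (3 vertices, pairwise adjacent) of the graph;
   - every edge lies in exactly two faces;
   - the link of every vertex is connected (hence, with the previous
     condition, a single cycle), so the complex is a closed 2-manifold;
   - the graph is connected and there is at least one face. *)
Definition surface_triangulation (e : rel T) (F : {set {set T}}) : Prop :=
  [/\ simple_graph e /\ F != set0,
      (forall f, f \in F -> #|f| = 3 /\
          (forall x y, x \in f -> y \in f -> x != y -> e x y)),
      (forall x y, e x y -> #|[set f in F | (x \in f) && (y \in f)]| = 2),
      (forall v u w, e v u -> e v w -> connect (link F v) u w)
    & (forall x y, connect e x y)].

(* Euler characteristic V - E + F = 1; a closed connected surface with Euler
   characteristic 1 is the projective plane. *)
Definition projective_plane_triangulation (e : rel T) (F : {set {set T}}) : Prop :=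
  surface_triangulation e F /\ (#|T| + #|F| = #|edges e| + 1)%N.

Definition bipartite_edges (H : {set {set T}}) : Prop :=
  exists c : T -> bool, forall x y, [set x; y] \in H -> c x != c y.

End Tri.

(* Main.v *)
Require Import Defs.
From HB Require Import structures.
From mathcomp Require Import all_boot all_algebra zify.

(** The dual of [G] is a cubic graph [Q] without bridges, in which the edges
    removed from [G] form a set [J].  Because the Euler characteristic is 1, the
    cuts of [G] have index at most 2 among the edge sets meeting every face
    evenly; hence there is a function [phi] from edges to Z/2 such that the
    complement of [J] is a cut as soon as [J] has odd degree at every vertex of
    [Q] and [phi J = phi E].  It remains to find such a [J] with at most
    [|V|/2 + 1] edges, which is possible in every bridgeless cubic graph and for
    every [phi].

    Suppose that [phi J = phi E + 1] for all such [J].  A maximal Tutte barrier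
    [B] of [Q] leaves [|B|] odd factor-critical components; counting edges, each
    of them is joined to [B] by exactly three edges and [B] is independent.
    Growing a component [S] by ears shows that [phi] is balanced on [S]: there is
    a potential [pi] with [phi xy = pi x + pi y] for the edges [xy] inside [S].
    After subtracting the potential, [phi] vanishes inside the components.
    Contracting them leaves a cubic bipartite graph, whose edges split into
    perfect matchings [M1], [M2], [M3], each of which extends to a perfect
    matching [Ji] of [Q].  Then [phi E] is the sum of the three [phi Ji], that is
    [3 (phi E + 1)], a contradiction. *)

Set Implicit Arguments. Unset Strict Implicit. Unset Printing Implicit Defensive.

(** * Hall's theorem *)

Section Hall.
Variables (X Y : finType) (R : X -> Y -> bool).

Definition nbrs (B : {set Y}) (A : {set X}) : {set Y} :=
  [set y in B | [exists x in A, R x y]].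

Lemma nbrsU B A1 A2 : nbrs B (A1 :|: A2) = nbrs B A1 :|: nbrs (B :\: nbrs B A1) A2.
Proof.
apply/setP=> y; rewrite !inE; case: (y \in B) => //=.
have -> : [exists x in A1 :|: A2, R x y] =
          [exists x in A1, R x y] || [exists x in A2, R x y].
  apply/exists_inP/orP => [[x]|].
    by rewrite inE => /orP[xA|xA] Rxy; [left|right]; apply/exists_inP; exists x.
  by case=> /exists_inP[x xA Rxy]; exists x => //; rewrite inE xA ?orbT.
by case: [exists x in A1, R x y].
Qed.

(** Halmos-Vaughan induction on [#|A|]: a tight proper nonempty subset and its complement are
    matched separately; if there is none, every such subset has a neighbour to spare, so any one
    edge may be taken and its ends removed. *)
Theorem hall (y0 : Y) (A : {set X}) (B : {set Y}) :
    (forall A' : {set X}, A' \subset A -> #|A'| <= #|nbrs B A'|) ->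
  exists2 f : X -> Y, {in A &, injective f}
    & forall x, x \in A -> (f x \in B) && R x (f x).
Proof.
have [n] := ubnP #|A|; elim: n A B => // n IHn A B /ltnSE leAn hallA.
have [->|[x xA]] := set_0Vmem A.
  by exists (fun=> y0) => x; rewrite inE.
pose tight (A1 : {set X}) := [&& A1 \proper A, A1 != set0 & #|nbrs B A1| <= #|A1|].
have [/existsP[A1 /and3P[A1pA A1n0 A1t]]|] := boolP [exists A1, tight A1].
  have sA1 := proper_sub A1pA.
  have [||f1 f1inj f1R] := IHn A1 (nbrs B A1).
  - exact: leq_trans (proper_card A1pA) leAn.
  - move=> A' sA'; apply: leq_trans (hallA A' (subset_trans sA' sA1)) _.
    apply: subset_leq_card; apply/subsetP=> y; rewrite !inE => /andP[-> ] /=.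
    case/exists_inP=> z zA' Rzy; apply/andP; split; apply/exists_inP; exists z => //.
    exact: (subsetP sA').
  have [||f2 f2inj f2R] := IHn (A :\: A1) (B :\: nbrs B A1).
  - move: A1n0; rewrite -card_gt0 => A1n0; have := cardsID A1 A.
    by rewrite (setIidPr sA1); lia.
  - move=> A' sA'; have [sA'A dA'] : A' \subset A /\ [disjoint A1 & A'].
      move: sA'; rewrite subsetD => /andP[-> ]; by rewrite disjoint_sym.
    (* Hall's condition for [A1 :|: A'], less the at most [#|A1|] neighbours of [A1], is the one
       needed for [A']. *)
    have /hallA : A1 :|: A' \subset A by rewrite subUset sA1.
    rewrite nbrsU !cardsU disjoint_setI0 // cards0.
    have -> : nbrs B A1 :&: nbrs (B :\: nbrs B A1) A' = set0.
      by apply/setP=> y; rewrite !inE; case: (y \in B) => //=; case: [exists x in A1, R x y].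
    by rewrite cards0; lia.
  exists (fun x => if x \in A1 then f1 x else f2 x) => [u v uA vA|u uA].
    case: ifP => uA1; case: ifP => vA1.
    - exact: f1inj.
    - have /andP[+ _] := f1R u uA1; have /andP[+ _] : (f2 v \in B :\: nbrs B A1) && R v (f2 v).
        by apply: f2R; rewrite inE vA1.
      by move=> + + E; rewrite -E inE => /andP[/negP].
    - have /andP[+ _] := f1R v vA1; have /andP[+ _] : (f2 u \in B :\: nbrs B A1) && R u (f2 u).
        by apply: f2R; rewrite inE uA1.
      by move=> + + E; rewrite E inE => /andP[/negP].
    - by apply: f2inj; rewrite inE ?uA1 ?vA1.
  case: ifP => uA1.
    by have /andP[] := f1R u uA1; rewrite inE => /andP[-> _] ->.
  by have /andP[] : (f2 u \in B :\: nbrs B A1) && R u (f2 u); [apply: f2R; rewrite inE uA1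
    | rewrite inE => /andP[_ ->] ->].
move/existsPn=> slack.
have /card_gt0P[y] : 0 < #|nbrs B [set x]|.
  by have := hallA [set x]; rewrite sub1set xA cards1; apply.
rewrite inE => /andP[yB /exists_inP[z]]; rewrite inE => /eqP-> Rxy.
have [||f finj fR] := IHn (A :\ x) (B :\ y).
- by move: leAn; rewrite (cardsD1 x A) xA.
- move=> A' sA'; have [->|A'n0] := eqVneq A' set0; first by rewrite cards0.
  have pA' : A' \proper A by apply: sub_proper_trans sA' (properD1 xA).
  have := slack A'; rewrite /tight pA' A'n0 /= -ltnNge.
  suff : #|nbrs B A'| <= #|nbrs (B :\ y) A'| + 1 by lia.
  rewrite -(cards1 y); apply: leq_trans (leq_card_setU _ _).
  apply: subset_leq_card; apply/subsetP=> u; rewrite !inE => /andP[-> ->].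
  by case: eqP.
exists (fun u => if u == x then y else f u) => [u v uA vA|u uA].
  have ne w : w \in A -> w != x -> f w != y.
    move=> wA wx; have /andP[] : (f w \in B :\ y) && R w (f w).
      by apply: fR; rewrite !inE wx.
    by rewrite !inE => /andP[].
  case: eqP => [->|/eqP ux]; case: eqP => [->|/eqP vx] //.
  - by move/eqP; rewrite eq_sym (negPf (ne _ vA vx)).
  - by move/eqP; rewrite (negPf (ne _ uA ux)).
  - by apply: finj; rewrite !inE ?ux ?vx.
case: eqP => [->|/eqP ux]; first by rewrite yB.
have /andP[] : (f u \in B :\ y) && R u (f u) by apply: fR; rewrite !inE ux.
by rewrite !inE => /andP[_ ->] ->.
Qed.

End Hall.

(** * Sums modulo 2 *)

Lemma xor_card (I : finType) (a : pred I) : \big[addb/false]_i a i = odd #|[set i | a i]|.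
Proof.
rewrite -sum1_card (big_morph odd oddD (erefl (odd 0))) big_mkcond [RHS]big_mkcond /=.
by apply: eq_bigr => i _; rewrite inE; case: (a i).
Qed.

Lemma xor_unique (I : finType) (A : {pred I}) (b : pred I) :
    (forall i j, i \in A -> j \in A -> b i -> b j -> i = j) ->
  \big[addb/false]_(i in A) b i = [exists i in A, b i].
Proof.
move=> bI; have [/exists_inP[i iA bi]|/exists_inPn nb] := boolP [exists i in A, b i].
  rewrite (bigD1 i) //= bi big1 // => j /andP[jA]; apply: contraNF => bj.
  by rewrite (bI j i).
by rewrite big1 // => i /nb/negPf.
Qed.

(** * Joins and Tutte barriers *)

Section Parity.
Variable E : Type.
Implicit Types (a : pred E) (L : seq E).

Definition parity a L := odd (count a L).

Lemma parity_cons a e L : parity a (e :: L) = a e (+) parity a L.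
Proof. by rewrite /parity /= oddD oddb. Qed.

Lemma parity_cat a L1 L2 : parity a (L1 ++ L2) = parity a L1 (+) parity a L2.
Proof. by rewrite /parity count_cat oddD. Qed.

Lemma parity_flatten (I : Type) (s : seq I) (F : I -> seq E) a :
  parity a (flatten [seq F i | i <- s]) = \big[addb/false]_(i <- s) parity a (F i).
Proof. by elim: s => [|i s IHs]; rewrite ?big_nil ?big_cons //= parity_cat IHs. Qed.

End Parity.

Section Joins.
Variables (V E : finType) (inc : V -> E -> bool).
Hypothesis inc2 : forall e, #|[set v | inc v e]| = 2.

(* Edge sets are sequences counted modulo 2: concatenation plays the role of the
   symmetric difference, and sizes add up without any disjointness condition. *)
Definition odd_degree (L : seq E) (v : V) := parity (inc v) L.
Local Notation bd := odd_degree.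

Lemma odd_degree_cat L1 L2 v : bd (L1 ++ L2) v = bd L1 v (+) bd L2 v.
Proof. exact: parity_cat. Qed.

Lemma odd_degree_cons e L v : bd (e :: L) v = inc v e (+) bd L v.
Proof. exact: parity_cons. Qed.

Lemma inc_exists e : exists a, inc a e.
Proof. by have /card_gt0P[a] : 0 < #|[set v | inc v e]|; [rewrite inc2 | rewrite inE; exists a]. Qed.

Lemma incE e a b v : inc a e -> inc b e -> a != b -> inc v e = (v == a) || (v == b).
Proof.
move=> ia ib ab; have : [set a; b] \subset [set v | inc v e].
  by apply/subsetP=> u; rewrite !inE => /orP[]/eqP->.
move=> /subset_leqif_cards[_]; rewrite cards2 ab inc2 eqxx => /esym/eqP/setP/(_ v).
by rewrite !inE.
Qed.

Lemma incX e a b v : inc a e -> inc b e -> a != b -> inc v e = (v == a) (+) (v == b).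
Proof.
move=> ia ib ab; rewrite (incE v ia ib ab).
by case: eqP => [->|//]; rewrite (negPf ab).
Qed.

Lemma inc_other e a : inc a e -> exists2 b, inc b e & a != b.
Proof.
move=> ia; have /card_gt0P[b] : 0 < #|[set v | inc v e] :\ a|.
  by have := cardsD1 a [set v | inc v e]; rewrite inc2 inE ia; lia.
by rewrite !inE => /andP[ba ib]; exists b => //; rewrite eq_sym.
Qed.

Lemma handshake L : \sum_v count (inc v) L = 2 * size L.
Proof.
elim: L => [|e L IHL]; first by rewrite big1 ?muln0.
rewrite /= mulnS -IHL big_split /= -(inc2 e) -sum1_card; congr (_ + _).
by rewrite [RHS]big_mkcond; apply: eq_bigr => v _; rewrite inE; case: inc.
Qed.

(** Each degree is at least its residue modulo 2, and by [handshake] the sum of the degrees is too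
    small for any of these inequalities to be strict. *)
Lemma count_tight (W : {set V}) N :
    (forall v, bd N v = (v \in W)) -> 2 * size N <= #|W| ->
  forall v, count (inc v) N = (v \in W).
Proof.
move=> bdN sN; have le v : (v \in W) <= count (inc v) N.
  by rewrite -bdN /odd_degree /parity; case: count => // n; case: odd.
have : \sum_v (v \in W : nat) = \sum_v count (inc v) N.
  apply/eqP; rewrite eqn_leq leq_sum ?handshake //=; apply: leq_trans sN _.
  rewrite -sum1_card big_mkcond; apply: leq_sum => v _; by case: (v \in W).
move=> sumE v; apply/eqP; rewrite eqn_leq le andbT leqNgt; apply/negP=> lt_v.
have : \sum_v (v \in W : nat) < \sum_v count (inc v) N.
  rewrite (bigD1 v) //= [X in _ < X](bigD1 v) //= -addSn leq_add //.
  by apply: leq_sum => u _.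
by rewrite sumE ltnn.
Qed.

(* The size bound makes [N] a perfect matching of [W]: its degrees are exactly 1 on
   [W] and 0 elsewhere, see [count_tight]. *)
Definition near_perfect (W : {set V}) (N : seq E) :=
  (forall v, bd N v = (v \in W)) /\ 2 * size N <= #|W|.

Definition matchable (W : {set V}) := exists N, near_perfect W N.

(** For [S \subset R], a union of components of the graph induced on [R]. *)
Definition closed_in (S R : {set V}) :=
  [forall e, [forall u in S, [forall v in R, inc u e ==> inc v e ==> (v \in S)]]].

Lemma closed_inP (S R : {set V}) :
  reflect (forall e u v, u \in S -> v \in R -> inc u e -> inc v e -> v \in S)
          (closed_in S R).
Proof.
apply: (iffP forallP) => [h e u v uS vR ue ve|h e].
  by have /forall_inP/(_ u uS)/forall_inP/(_ v vR) := h e; rewrite ue ve.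
apply/forall_inP=> u uS; apply/forall_inP=> v vR; apply/implyP=> ue; apply/implyP.
exact: h uS vR ue.
Qed.

Definition odd_family (W B : {set V}) (P : {set {set V}}) :=
  trivIset P && [forall S in P, [&& odd #|S|, S \subset W :\: B & closed_in S (W :\: B)]].

Lemma odd_familyP W B P :
  reflect [/\ trivIset P, forall S, S \in P -> odd #|S|,
             forall S, S \in P -> S \subset W :\: B &
             forall S, S \in P -> closed_in S (W :\: B)]
          (odd_family W B P).
Proof.
apply: (iffP andP) => [[tP /forall_inP h]|[tP o s c]].
  by split=> // S /h /and3P[].
by split=> //; apply/forall_inP=> S SP; rewrite o ?s ?c.
Qed.

(* Tutte's condition for the graph induced on [W].  Families of disjoint odd sets
   without edges to the rest of [W :\: B] stand for the odd components, so that
   components need not be formed. *)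
Definition tutte (W : {set V}) :=
  forall (B : {set V}) P, B \subset W -> odd_family W B P -> #|P| <= #|B|.

Lemma odd_cover (P : {set {set V}}) :
  trivIset P -> (forall S, S \in P -> odd #|S|) -> odd #|cover P| = odd #|P|.
Proof.
move=> /eqP <- oP; rewrite -sum1_card.
rewrite !(big_morph odd oddD (erefl (odd 0))); apply: eq_bigr => S /oP ->; by [].
Qed.

Lemma odd_family_parity (W B : {set V}) P : B \subset W -> odd_family W B P ->
  odd #|W| = odd #|B| (+) odd #|P| (+) odd #|W :\: B :\: cover P|.
Proof.
move=> sB /odd_familyP[tP oP sP _]; rewrite -(odd_cover tP oP) -!oddD.
have sC : cover P \subset W :\: B by apply/bigcupsP=> S /sP.
by congr odd; have := cardsID B W; have := cardsID (cover P) (W :\: B);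
  rewrite (setIidPr sB) (setIidPr sC); lia.
Qed.

(** No edge leads from [R] into the closed sets of [P], so an odd remainder is one more member of
    the family. *)
Lemma odd_family_leftover W B P (R := W :\: B :\: cover P) :
  odd_family W B P -> odd #|R| -> odd_family W B (R |: P) /\ #|R |: P| = #|P|.+1.
Proof.
move=> /odd_familyP[tP oP sP cP] oR.
have [] : trivIset (R |: P) /\ R \notin P.
  apply: trivIsetU1 => //.
    move=> S SP; rewrite -setI_eq0; apply/eqP/setP=> v; rewrite !inE.
    apply/negP => /andP[/andP[nC _] vS]; case/negP: nC; by apply/bigcupP; exists S.
  by apply/negP => /oP; rewrite cards0.
move=> tRP RP; split; last by rewrite cardsU1 RP.
apply/odd_familyP; split=> //.
- by move=> S /setU1P[->|/oP].
- by move=> S /setU1P[->|/sP//]; rewrite subsetDl.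
move=> S /setU1P[->|/cP//]; apply/closed_inP=> e u v.
rewrite inE => /andP[uC uWB] vWB ue ve; rewrite inE vWB andbT.
apply: contra uC => /bigcupP[T TP vT]; apply/bigcupP; exists T => //.
by have /closed_inP/(_ e v u vT uWB ve ue) := cP T TP.
Qed.

Lemma closed_in_sub (S R R' : {set V}) : R' \subset R -> closed_in S R -> closed_in S R'.
Proof.
move=> /subsetP sR /closed_inP cS; apply/closed_inP=> e u v uS /sR; exact: cS.
Qed.

(* Anderson's argument: take [B] maximal with [#|P| = #|B|].  A vertex outside [B]
   and the sets of [P], or a set violating Tutte's condition in [S :\ x] (by at least
   2, for parity reasons), would enlarge [B]. *)
Lemma tutte_barrier W : tutte W -> exists (B : {set V}) P,
  [/\ B \subset W, odd_family W B P, #|P| = #|B|, cover P = W :\: B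
    & forall S x, S \in P -> x \in S -> tutte (S :\ x)].
Proof.
move=> tW.
pose ok (p : {set V} * {set {set V}}) :=
  [&& p.1 \subset W, odd_family W p.1 p.2 & #|p.2| == #|p.1|].
have ok0 : ok (set0, set0).
  rewrite /ok /= sub0set !cards0 eqxx andbT; apply/odd_familyP; split=> [|S|S|S]; rewrite ?inE //.
  by rewrite /trivIset /cover !big_set0 cards0.
(* Tutte's condition for the empty barrier and the single set [W]. *)
have evW : ~~ odd #|W|.
  apply/negP=> oW; have := tW set0 [set W]; rewrite sub0set cards0 cards1 => /(_ isT).
  suff -> : odd_family W set0 [set W] by move=> /(_ isT).
  apply/odd_familyP; split=> [|S|S|S]; rewrite ?inE => //; last 3 first.
  - by move/eqP->.
  - by move/eqP->; rewrite setD0.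
  - by move/eqP->; apply/closed_inP=> e u v _; rewrite setD0.
  by rewrite /trivIset /cover !big_set1.
case: (@arg_maxnP _ (set0, set0) ok (fun p => #|p.1|) ok0) => [[B P]] /and3P[/= sB fP /eqP cP] maxB.
have {}maxB (B' : {set V}) P' : B' \subset W -> odd_family W B' P' -> #|B'| <= #|P'| -> #|B'| <= #|B|.
  move=> sB' fP' le; apply: (maxB (B', P')); rewrite /ok /= sB' fP' /=.
  by rewrite eqn_leq le tW.
exists B, P; split=> //.
  have sC : cover P \subset W :\: B.
    by have /odd_familyP[_ _ sP _] := fP; apply/bigcupsP=> S /sP.
  apply/eqP; rewrite eqEsubset sC /= -setD_eq0; apply/set0Pn => -[x xR].
  have xB : x \notin B by move: xR; rewrite !inE => /and3P[].
  have xW : x \in W by move: xR; rewrite !inE => /and3P[].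
  (* As [#|P| = #|B|] and [#|W|] is even, the remainder is even. Moving [x] into the barrier makes
     it odd, so that [P] gains a member as well. *)
  have := odd_family_parity sB fP; rewrite cP addbb (negPf evW) /= => /esym/negbT evR.
  have sBx : x |: B \subset W by rewrite subUset sub1set xW.
  have fP' : odd_family W (x |: B) P.
    have /odd_familyP[tP oP sP clP] := fP; apply/odd_familyP; split=> // S SP.
      apply/subsetP=> v vS; have := subsetP (sP S SP) v vS; rewrite !inE => /andP[/negPf-> ->].
      rewrite orbF andbT; apply: contraL xR => /eqP <-; rewrite inE negb_and negbK.
      by apply/orP; left; apply/bigcupP; exists S.
    by apply: closed_in_sub (clP S SP); apply: setDS; apply: subsetUr.
  have RE : W :\: (x |: B) :\: cover P = (W :\: B :\: cover P) :\ x.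
    by apply/setP=> v; rewrite !inE; case: eqP; rewrite ?andbF //= ; case: (v \in cover P).
  have [|f c] := odd_family_leftover fP'.
    by move: evR; rewrite (cardsD1 x) xR RE /= negbK.
  by have := maxB _ _ sBx f; rewrite c cardsU1 xB cP => /(_ (leqnn _)); rewrite ltnn.
move=> S x SP xS B1 P1 sB1 fP1; rewrite leqNgt; apply/negP=> lt1.
have /odd_familyP[tP oP sP clP] := fP.
have evS : ~~ odd #|S :\ x| by have := oP S SP; rewrite (cardsD1 x) xS.
(* [#|S :\ x|] is even, so either [#|P1|] and [#|B1|] have equal parity and differ by at least 2, or
   the remainder is odd and joins the family. *)
have [P2 fP2 c2] : exists2 P2, odd_family (S :\ x) B1 P2 & #|B1| + 2 <= #|P2|.
  have := odd_family_parity sB1 fP1; rewrite (negPf evS).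
  case: (boolP (odd #|S :\ x :\: B1 :\: cover P1|)) => oR parity.
    have [f c] := odd_family_leftover fP1 oR.
    by exists (S :\ x :\: B1 :\: cover P1 |: P1); rewrite // c addn2 ltnS.
  have oBP : odd #|B1| = odd #|P1|.
    by move: parity; rewrite addbF; case: odd; case: odd.
  by exists P1 => //; move: oBP lt1; clear; lia.
have /odd_familyP[tP2 oP2 sP2 clP2] := fP2.
have sub2 T : T \in P2 -> T \subset S.
  by move/sP2=> sT; apply: subset_trans sT _; apply: subset_trans (subsetDl _ _) (subD1set _ _).
have disj T : T \in P :\ S -> [disjoint T & S].
  by rewrite !inE => /andP[TS TP]; apply: (trivIsetP tP).
(* Replacing [S] by the sets of [P2] loses one member and gains at least [#|B1| + 2], which pays for
   the [#|B1| + 1] new barrier vertices. *)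
pose B2 := x |: (B :|: B1); pose P3 := (P :\ S) :|: P2.
have SB v : v \in S -> (v \in W) && (v \notin B).
  by move=> vS; have := subsetP (sP S SP) v vS; rewrite inE andbC.
have S1 v : v \in B1 -> (v \in S) && (v != x).
  by move=> vB; have := subsetP sB1 v vB; rewrite !inE andbC.
have sB2 : B2 \subset W.
  rewrite !subUset sub1set sB /= (proj1 (andP (SB x xS))) /=.
  by apply/subsetP=> v /S1/andP[/SB/andP[]].
have cB2 : #|B2| = (#|B| + #|B1|).+1.
  rewrite cardsU1 !inE negb_or (proj2 (andP (SB x xS))) /=.
  have -> : x \notin B1 by apply/negP=> /S1; rewrite eqxx andbF.
  rewrite cardsU; have -> : B :&: B1 = set0; last by rewrite cards0 subn0.
  apply/setP=> v; rewrite !inE; apply/negP=> /andP[vB /S1/andP[/SB]].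
  by rewrite vB andbF.
have cP3 : #|P3| = (#|P|).-1 + #|P2|.
  rewrite cardsU (cardsD1 S P) SP /=; have -> : (P :\ S) :&: P2 = set0; last by rewrite cards0 subn0.
  apply/setP=> T; rewrite in_setI in_set0; apply/negP=> /andP[/disj dT TP2].
  have := oP2 T TP2; have := sub2 T TP2; move: dT; rewrite -setI_eq0 => /eqP dT /setIidPl.
  by rewrite dT => <-; rewrite cards0.
have fP3 : odd_family W B2 P3.
  apply/odd_familyP; split.
  - apply/trivIsetP=> T T'; rewrite !in_setU => /orP[TP|TP] /orP[TP'|TP'] TT'.
    + by move: TP TP'; rewrite !inE => /andP[_ TP] /andP[_ TP']; apply: (trivIsetP tP).
    + by apply: disjointWr (sub2 _ TP') (disj _ TP).
    + by rewrite disjoint_sym; apply: disjointWr (sub2 _ TP) (disj _ TP').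
    + exact: (trivIsetP tP2).
  - move=> T; rewrite in_setU in_setD1 => /orP[/andP[_ /oP]|/oP2] //.
  - move=> T; rewrite in_setU => /orP[TP|TP]; apply/subsetP=> v vT.
      have vS : v \notin S by have := disjointFr (disj T TP) vT => ->.
      move: TP; rewrite in_setD1 => /andP[_ TP]; have := subsetP (sP T TP) v vT.
      rewrite !inE => /andP[/negPf-> ->]; rewrite andbT /=; apply/norP; split.
        by apply: contraNneq vS => ->.
      by apply: contra vS => /S1/andP[].
    have := subsetP (sP2 T TP) v vT; rewrite !inE => /and3P[/negPf-> /negPf-> /SB/andP[-> /negPf->]].
    by [].
  - move=> T; rewrite in_setU => /orP[|TP].
      rewrite in_setD1 => /andP[_ TP]; apply: closed_in_sub (clP T TP).
      by apply: setDS; rewrite /B2 setUCA subsetUl.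
    apply/closed_inP=> e u v uT; rewrite !inE !negb_or => /andP[/and3P[vx vB vB1] vW] ue ve.
    have uS := subsetP (sub2 T TP) u uT.
    have vS : v \in S by have /closed_inP := clP S SP; apply; rewrite ?inE ?vB //; [exact: uS|exact: ue|exact: ve].
    by have /closed_inP := clP2 T TP; apply; [exact: uT | rewrite !inE vx vB1 | exact: ue | exact: ve].
have P_gt0 : 0 < #|P| by rewrite (cardsD1 S) SP.
have := maxB _ _ sB2 fP3; rewrite cB2 cP3 => {}maxB.
suff : (#|B| + #|B1|).+1 <= #|B| by rewrite -addSn ltnNge leq_addr.
have aux p q b : 0 < p -> b + 2 <= q -> (p + b).+1 <= p.-1 + q by clear; lia.
by apply: maxB; rewrite -cP; apply: aux.
Qed.

End Joins.

(** * Tutte's theorem from maximal barriers *)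

Section Joins.
Variables (V E : finType) (inc : V -> E -> bool).
Hypothesis inc2 : forall e, #|[set v | inc v e]| = 2.
Local Notation bd := (odd_degree inc).

(* [S] is matched to the vertex [f S] of [B] by the edge [g S], whose end in [S] is
   [x S]; inside [S], [N S] covers what remains. *)
Section Assemble.
Variables (W B : {set V}) (P : {set {set V}}).
Variables (f : {set V} -> V) (g : {set V} -> E) (x : {set V} -> V) (N : {set V} -> seq E).
Hypotheses (sB : B \subset W) (tP : trivIset P) (cP : cover P = W :\: B).
Hypotheses (fI : {in P &, injective f}) (PB : #|P| = #|B|).
Hypothesis fB : forall S, S \in P -> f S \in B.
Hypothesis gP : forall S, S \in P -> [/\ x S \in S, inc (f S) (g S) & inc (x S) (g S)].
Hypothesis bdN : forall S v, S \in P -> bd (N S) v = (v \in S :\ x S).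

Definition assemble := flatten [seq g K :: N K | K <- enum P].

Lemma odd_degree_assemble v : bd assemble v = (v \in W).
Proof.
rewrite /odd_degree parity_flatten big_enum /=.
(* The edge [g S] and [N S] together cover [S] and [f S]; these sets partition [W], as [f] is onto
   [B] by cardinality. *)
rewrite (eq_bigr (fun S => (v == f S) (+) (v \in S))) => [|S SP]; last first.
  have [xS if_ ix] := gP SP; have := bdN v SP; rewrite parity_cons /odd_degree => ->.
  have nfx : f S != x S.
    apply: contraTneq (fB SP) => ->; have : x S \in cover P by apply/bigcupP; exists S.
    by rewrite cP inE => /andP[].
  rewrite (incX inc2 v if_ ix nfx) !inE -addbA; congr (_ (+) _).
  by have [->|] := eqVneq v (x S); rewrite ?xS.
rewrite big_split /= !xor_unique.
- have -> : [exists S in P, v \in S] = (v \in W :\: B).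
    by rewrite -cP; apply/exists_inP/bigcupP => -[S SP vS]; exists S.
  have -> : [exists S in P, v == f S] = (v \in B).
    have -> : B = [set f S | S in P].
      apply/esym/eqP; rewrite eqEcard card_in_imset // PB leqnn andbT.
      by apply/subsetP=> _ /imsetP[S SP ->]; exact: fB.
    by apply/exists_inP/imsetP => -[S SP]; [move/eqP|move=> ->]; exists S.
  by rewrite inE; have := subsetP sB v; case: (v \in B) => //= ->.
- move=> S S' SP SP' vS vS'; apply/eqP; apply: contraT => ne.
  by have := disjointFr (trivIsetP tP S S' SP SP' ne) vS; rewrite vS'.
- by move=> S S' SP SP' /eqP -> /eqP; apply: fI.
Qed.

(** [ex S] is twice the number of edges that [N S] may have beyond a near-perfect matching. [#|W|]
    is the sum of the [#|S| + 1] because [#|P| = #|B|]. *)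
Lemma size_assemble (ex : {set V} -> nat) :
  (forall S, S \in P -> 2 * size (N S) + 1 <= #|S| + ex S) ->
  2 * size assemble <= #|W| + \sum_(S in P) ex S.
Proof.
move=> sN; have -> : #|W| = \sum_(S in P) (#|S| + 1).
  rewrite big_split /= (eqP tP) cP sum1_card PB -(cardsID B W) (setIidPr sB).
  exact: addnC.
rewrite -big_split /= size_flatten /shape -map_comp sumnE big_map big_enum /=.
rewrite big_distrr; apply: leq_sum => S SP /=; move: (sN S SP).
by move: (size _) (ex S) #|S| => a b c; clear; lia.
Qed.

End Assemble.

(** Once their neighbours in [B] are removed, the sets of a subfamily have no edges to the rest of
    [W]; so Hall's condition is Tutte's condition with these neighbours as barrier. *)
Lemma barrier_hall (W B : {set V}) P : tutte inc W -> B \subset W -> odd_family inc W B P ->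
  forall v0 : V, exists2 f : {set V} -> V, {in P &, injective f}
  & forall S, S \in P -> (f S \in B) && [exists e, inc (f S) e && [exists u in S, inc u e]].
Proof.
move=> tW sB /odd_familyP[tP oP sP clP] v0.
pose R (S : {set V}) b := [exists e, inc b e && [exists u in S, inc u e]].
apply: (hall (R := R) v0) => P' sP'; have sNB : nbrs R B P' \subset B.
  by apply/subsetP=> v; rewrite inE => /andP[].
apply: tW; first exact: subset_trans sNB sB.
apply/odd_familyP; split=> [|S /(subsetP sP')/oP//|S /(subsetP sP') SP|S SP'].
- by apply/trivIsetP=> S S' /(subsetP sP') SP /(subsetP sP'); apply: (trivIsetP tP).
- by apply: subset_trans (sP S SP) _; apply: setDS.
apply/closed_inP=> e u v uS; rewrite inE => /andP[vN vW] ue ve.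
have SP := subsetP sP' S SP'.
have /closed_inP/(_ e u v uS) := clP S SP; apply=> //; rewrite inE vW andbT.
apply: contra vN => vB; rewrite inE vB /=; apply/exists_inP; exists S => //.
by apply/existsP; exists e; rewrite ve; apply/exists_inP; exists u.
Qed.

(** Hall's theorem matches each set [S] of a maximal barrier to a vertex of [B]; what is left of [S]
    satisfies Tutte's condition and is matched by induction. *)
Theorem tutte_matchable W : tutte inc W -> matchable inc W.
Proof.
have [n] := ubnP #|W|; elim: n W => // n IHn W /ltnSE leWn tW.
have [->|[v0 v0W]] := set_0Vmem W.
  by exists [::]; split=> [v|]; rewrite ?inE ?cards0.
have [B [P [sB fP cP covP crit]]] := tutte_barrier tW.
have [f fI fR] := barrier_hall tW sB fP v0.
have /odd_familyP[tP oP sP _] := fP.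
have [S0 S0P] : exists S0, S0 \in P.
  apply/set0Pn; apply: contraL v0W => /eqP P0; move: covP cP.
  rewrite P0 /cover big_set0 cards0 => + /esym/cards0_eq B0; rewrite B0 setD0 => <-.
  by rewrite inE.
have /andP[_ /existsP[e0 _]] := fR S0 S0P.
have ch (S : {set V}) : exists t : E * V * seq E, S \in P ->
    [/\ t.1.2 \in S, inc (f S) t.1.1, inc t.1.2 t.1.1 & near_perfect inc (S :\ t.1.2) t.2].
  have [SP|_] := boolP (S \in P); last by exists (e0, v0, [::]).
  have /andP[_ /existsP[e /andP[fe /exists_inP[u uS ue]]]] := fR S SP.
  have [] := IHn (S :\ u); last by move=> N NP; exists (e, u, N).
    apply: leq_trans leWn; have : S \subset W by apply: subset_trans (sP S SP) (subsetDl _ _).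
    by move/subset_leq_card; rewrite (cardsD1 u) uS.
  exact: crit SP uS.
have [t tE] := fin_all_exists ch.
exists (assemble P (fun S => (t S).1.1) (fun S => (t S).2)); split=> [v|].
  apply: (@odd_degree_assemble W B P f _ (fun S => (t S).1.2)) => //.
  - by move=> S /fR/andP[].
  - by move=> S /tE[].
  - by move=> S u /tE[_ _ _ []].
have -> : #|W| = #|W| + \sum_(S in P) 0 by rewrite big1 ?addn0.
apply: (size_assemble (B := B)) => // S SP; have [xS _ _ [_ sN]] := tE S SP.
by rewrite addn0 (cardsD1 (t S).1.2 S) xS addnC leq_add2l.
Qed.

End Joins.

(** * Ears of a factor-critical set *)

(* Here [n] and [n'] map a vertex to its mate in two matchings missing [u] and [y], and
   [f = n' \o n] moves two edges along the path from [y] in their union.  Since [n]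
   reverses the orbit of [y] under [f], this orbit has odd length and its middle
   element is fixed by [n], so that it is [u]. *)
Section Zigzag.
Variables (V : finType) (n n' : V -> V) (K X : {set V}) (u y : V).
Hypotheses (nK : involutive n) (n'K : involutive n').
Hypotheses (nS : forall v, v \in K -> n v \in K) (n'S : forall v, v \in K -> n' v \in K).
Hypotheses (n_fix : forall v, v \in K -> n v = v -> v = u).
Hypotheses (n'_fix : forall v, v \in K -> n' v = v -> v = y) (n'y : n' y = y).
Hypotheses (yK : y \in K) (uX : u \in X) (yX : y \notin X).
Hypothesis (nX : forall v, v \in X -> n v \in X).

Let f v := n' (n v).

Definition zigzag k := flatten [seq [:: iter t f y; n (iter t f y)] | t <- iota 0 k].

Lemma zigzag_to : exists k,
  [/\ 0 < k, iter k f y \in X, forall v, v \in zigzag k -> v \in K :\: X,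
      uniq (zigzag k) & forall t, t < k -> n (iter t f y) != y].
Proof.
have fE v : f v = n' (n v) by [].
have fI : injective f by apply: inj_comp; [exact: inv_inj n'K | exact: inv_inj nK].
have fK t : iter t f y \in K by elim: t => //= t IHt; rewrite n'S ?nS.
pose p := order f y.
have p_gt0 : 0 < p by apply: order_gt0.
have inj_iter s t : s < p -> t < p -> iter s f y = iter t f y -> s = t.
  move=> sp tp st; apply/eqP.
  by rewrite -(@nth_uniq _ y (orbit f y)) ?orbit_uniq ?size_traject // !nth_traject // st.
(* [n] conjugates [f] to its inverse and, because [n'] fixes [y], sends [y] to its predecessor. *)
have flip t : t < p -> n (iter t f y) = iter (p.-1 - t) f y.
  elim: t => [_|t IHt lt_t].
    rewrite subn0 -[LHS]nK; apply: (inv_inj nK); rewrite nK.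
    have := iter_order fI y; rewrite -/p -(prednK p_gt0) iterS fE => fp.
    by rewrite -[RHS]n'K fp n'y.
  have /IHt E : t < p by apply: ltnW.
  rewrite iterS fE E.
  have -> : p.-1 - t = (p.-1 - t.+1).+1 by lia.
  by rewrite iterS fE n'K nK.
(* For an even [p], [n'] would fix the element with index [p./2], which would then be [y]. *)
have [h ph] : exists h, p = h.*2.+1.
  exists p./2; apply/eqP; rewrite -[X in X == _]odd_double_half eq_sym -add1n eqn_add2r.
  have [//|ev] := boolP (odd p); have pE : p = p./2.*2 by rewrite -[LHS]odd_double_half (negPf ev).
  have h1 : p./2.-1 < p by lia.
  have E := flip _ h1; have hh : p.-1 - p./2.-1 = p./2.-1.+1 by lia.
  have fx : n' (iter p./2.-1.+1 f y) = iter p./2.-1.+1 f y.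
    by rewrite {1}iterS fE n'K E hh.
  have := n'_fix (fK _) fx; rewrite -[RHS]/(iter 0 f y) => /inj_iter; lia.
have hX : iter h f y \in X.
  suff -> : iter h f y = u by [].
  apply: n_fix => //; rewrite flip; last by lia.
  by congr (iter _ f y); lia.
have ex : exists k, iter k f y \in X by exists h.
case: (ex_minnP ex) => k kX minK; have kh := minK _ hX.
have k_gt0 : 0 < k by case: k kX {minK kh} => //=; rewrite (negPf yX).
have outX t : t < k -> iter t f y \notin X by apply: contraL => /minK; rewrite -leqNgt.
exists k; split=> //.
- move=> v /flattenP[_ /mapP[t + ->]]; rewrite mem_iota /= add0n => tk.
  rewrite !inE => /orP[]/eqP->; rewrite ?outX ?fK ?nS // andbT.
  by apply: contra (outX t tk) => /nX; rewrite nK.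
(* As [k <= h], the mates have indices above [h] and the other vertices indices below [h]. *)
- have perm : perm_eq (zigzag k)
     ([seq iter t f y | t <- iota 0 k] ++ [seq iter (p.-1 - t) f y | t <- iota 0 k]).
    rewrite /zigzag; have : {subset iota 0 k <= [pred t | t < p]}.
      by move=> t; rewrite mem_iota !inE; lia.
    elim: (iota 0 k) => //= t s IHs sub.
    rewrite perm_cons perm_sym -[_ :: map _ s]cat1s perm_catCA /= flip; last first.
      by apply: sub; rewrite inE eqxx.
    by rewrite perm_cons perm_sym; apply: IHs => r rs; apply: sub; rewrite inE rs orbT.
  rewrite (perm_uniq perm) cat_uniq !map_inj_in_uniq ?iota_uniq ?andbT /=.
  + apply/hasPn=> _ /mapP[t + ->]; rewrite mem_iota => tk; apply/mapP=> -[s].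
    by rewrite mem_iota => sk /inj_iter; lia.
  + by move=> s t; rewrite !mem_iota => sk tk /inj_iter; lia.
  + by move=> s t; rewrite !mem_iota => sk tk /inj_iter; lia.
- move=> t tk; rewrite flip; last by lia.
  by apply/eqP; rewrite -[RHS]/(iter 0 f y) => /inj_iter; lia.
Qed.

End Zigzag.

Section Joins.
Variables (V E : finType) (inc : V -> E -> bool).
Hypothesis inc2 : forall e, #|[set v | inc v e]| = 2.
Local Notation bd := (odd_degree inc).

Definition adjacent a b := (a != b) && [exists e, inc a e && inc b e].

Local Notation adj := adjacent.

Lemma count1_inj (s : seq E) (a : pred E) e e' :
  count a s = 1 -> e \in s -> e' \in s -> a e -> a e' -> e = e'.
Proof.
move=> c es e's ae ae'; have : e \in filter a s by rewrite mem_filter ae.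
have : e' \in filter a s by rewrite mem_filter ae'.
move: c; rewrite -size_filter; case: filter => // z [|//] _.
by rewrite !inE => /eqP-> /eqP->.
Qed.

Lemma mate_exists W N : near_perfect inc W N -> exists n : V -> V,
  [/\ involutive n,
      forall v, v \notin W -> n v = v,
      forall v, v \in W -> (n v \in W) && adj v (n v)
    & forall e a b, e \in N -> inc a e -> inc b e -> a != b -> n a = b].
Proof.
move=> [bdN sN]; have ct := count_tight inc2 bdN sN.
have memW e a : e \in N -> inc a e -> a \in W.
  move=> eN ae; have := ct a; have : 0 < count (inc a) N by rewrite -has_count; apply/hasP; exists e.
  by case: (a \in W) => // lt0 c0; rewrite c0 in lt0.
pose n v := if [pick b | (b != v) && has (fun e => inc v e && inc b e) N] is Some b then b else v.
have nE e a b : e \in N -> inc a e -> inc b e -> a != b -> n a = b.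
  move=> eN ae be ab; rewrite /n; case: pickP => [c /andP[ca /hasP[e' e'N /andP[ae' ce']]]|].
    have Ee : e = e' by apply: (@count1_inj N (inc a)) => //; rewrite ct (memW e a).
    move: ce'; rewrite -Ee (incE inc2 c ae be ab) (negPf ca) /= => /eqP ->; by [].
  move=> /(_ b); rewrite eq_sym ab /= => /hasP[]; by exists e; rewrite // ae.
have nW v : v \in W -> exists e, [/\ e \in N, inc v e, inc (n v) e & v != n v].
  move=> vW; have /hasP[e eN ve] : has (inc v) N by rewrite has_count ct vW.
  have [b be vb] := inc_other inc2 ve.
  by exists e; rewrite (nE e v b).
have nV v : v \notin W -> n v = v.
  move=> vW; rewrite /n; case: pickP => // b /andP[_ /hasP[e eN /andP[ve _]]].
  by rewrite (memW e v) in vW.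
exists n; split=> // v.
  have [/nW[e [eN ve nve vn]]|vW] := boolP (v \in W); last by rewrite !nV.
  by apply: nE nve ve _ => //; rewrite eq_sym.
move=> /nW[e [eN ve nve vn]]; rewrite (memW e) //= /adjacent vn; apply/existsP; exists e.
by rewrite ve.
Qed.

Lemma near_perfect_sub W N (n : V -> V) (Z : {set V}) : near_perfect inc W N ->
    (forall e a b, e \in N -> inc a e -> inc b e -> a != b -> n a = b) ->
    Z \subset W -> (forall v, v \in Z -> n v \in Z) ->
  matchable inc Z.
Proof.
move=> [bdN sN] nE sZ nZ; have ct := count_tight inc2 bdN sN.
pose R := [seq e <- N | [exists v in Z, inc v e]].
have ctR v : count (inc v) R = (v \in Z).
  rewrite count_filter; have [vZ|vZ] := boolP (v \in Z).
    rewrite -[RHS]/(nat_of_bool true) -(subsetP sZ v vZ) -ct; apply: eq_count => e /=.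
    by apply: andb_idr => ve; apply/exists_inP; exists v.
  apply/eqP; rewrite -leqn0 leqNgt -has_count; apply/hasPn=> e eN /=.
  apply/negP=> /andP[ve /exists_inP[a aZ ae]].
  have av : a != v by apply: contraNneq vZ => <-.
  by move: vZ; rewrite -(nE _ _ _ eN ae ve av) nZ.
exists R; split=> [v|]; first by rewrite /odd_degree /parity ctR oddb.
rewrite -(handshake inc2) -sum1_card [X in _ <= X]big_mkcond; apply: leq_sum => v _.
by rewrite ctR; case: (v \in Z).
Qed.

(** The ear alternates between [N] and [N'] from [y] to the first vertex in [X]. Its vertices come
    in pairs matched by [N], so [n] preserves the enlarged set and the next ear can use the same
    [N]. *)
Lemma ear_to (K X : {set V}) u y N N' (n : V -> V) :
    near_perfect inc (K :\ u) N -> near_perfect inc (K :\ y) N' ->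
    involutive n -> (forall v, v \notin K :\ u -> n v = v) ->
    (forall v, v \in K :\ u -> (n v \in K :\ u) && adj v (n v)) ->
    (forall v, v \in X -> n v \in X) -> u \in X -> u \in K -> y \in K -> y \notin X ->
  exists s z j, [/\ z \in X /\ path adj y (rcons s z), uniq (y :: s),
     {subset y :: s <= K :\: X}, (size s).+1 = j.*2
     & forall v, v \in y :: s -> n v \in y :: s].
Proof.
move=> NP NP' nK nV nW nX uX uK yK yX.
have [n' [n'K n'V n'W _]] := mate_exists NP'.
have stab (m : V -> V) w : w \in K -> (forall v, v \notin K :\ w -> m v = v) ->
    (forall v, v \in K :\ w -> (m v \in K :\ w) && adj v (m v)) ->
    forall v, v \in K -> m v \in K.
  move=> wK mV mW v vK; have [vw|/mV->//] := boolP (v \in K :\ w).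
  by have /andP[] := mW v vw; rewrite inE => /andP[].
have fixm (m : V -> V) w : (forall v, v \in K :\ w -> (m v \in K :\ w) && adj v (m v)) ->
    forall v, v \in K -> m v = v -> v = w.
  move=> mW v vK mv; apply/eqP; apply: contraT => vw.
  by have /mW/andP[_] : v \in K :\ w; rewrite ?inE ?vw // mv /adjacent eqxx.
have n'y : n' y = y by rewrite n'V // !inE eqxx.
have nS := stab n u uK nV nW; have n'S := stab n' y yK n'V n'W.
have [k [k_gt0 kX sub un ny]] := zigzag_to nK n'K nS n'S
   (fixm n u nW) (fixm n' y n'W) n'y yK uX yX nX.
pose f v := n' (n v).
have kz : zigzag n n' y k = y :: behead (zigzag n n' y k).
  by rewrite /zigzag -(prednK k_gt0).
exists (behead (zigzag n n' y k)), (iter k f y), k; rewrite -kz; split=> //; first split=> //.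
- have fK t : iter t f y \in K by elim: t => //= t IHt; rewrite n'S ?nS.
  have iterX t : t < k -> iter t f y \in K :\: X.
    move=> tk; apply: sub; apply/flattenP; exists [:: iter t f y; n (iter t f y)].
      by apply/mapP; exists t; rewrite ?mem_iota.
    by rewrite inE eqxx.
  have a1 t : t < k -> adj (iter t f y) (n (iter t f y)).
    move=> /iterX; rewrite inE => /andP[tX tK]; apply: (proj2 (andP (nW _ _))).
    by rewrite !inE tK andbT; apply: contraNneq tX => ->.
  have a2 t : t < k -> adj (n (iter t f y)) (iter t.+1 f y).
    move=> tk; apply: (proj2 (andP (n'W (n (iter t f y)) _))).
    by rewrite !inE ny // nS.
  have a3 i j v : i + j <= k -> adj v (iter i f y) || (j == 0) && (v == iter i f y) ->
      path adj v (if j == 0 then [::] else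
         rcons (flatten [seq [:: iter t f y; n (iter t f y)] | t <- iota i j]) (iter (i + j) f y)).
    elim: j i v => //= j IHj i v ij; rewrite orbF => ->; rewrite a1 /=; last by lia.
    case: j IHj ij => [|j] IHj ij; first by rewrite /= addn1 a2 //; lia.
    rewrite -addSnnS; apply: (IHj i.+1); first by lia.
    by rewrite a2 //; lia.
  have := @a3 0 k; rewrite gtn_eqF // add0n /= -/(zigzag n n' y k) => a4.
  (* [a3] describes a path entered from a neighbour of its first vertex; [n y] serves as that
     neighbour, and the entering edge is dropped. *)
  have [z az] : exists z, adj z y.
    exists (n y); have := a1 0 k_gt0; rewrite /= /adjacent eq_sym => /andP[-> /existsP[e]].
    by rewrite andbC => ?; apply/existsP; exists e.
  have := a4 z (leqnn _); rewrite az => /(_ isT); by rewrite {1}kz /= => /andP[].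
- have size_zz i j : size (flatten [seq [:: iter t f y; n (iter t f y)] | t <- iota i j]) = j.*2.
    by elim: j i => //= j IHj i; rewrite IHj doubleS.
  by rewrite size_behead size_zz prednK // double_gt0.
- move=> v /flattenP[_ /mapP[t tk ->]] vt; apply/flattenP.
  exists [:: iter t f y; n (iter t f y)]; first by apply/mapP; exists t.
  by move: vt; rewrite !inE => /orP[]/eqP->; rewrite ?nK eqxx ?orbT.
Qed.

End Joins.

(** * Selections along paths, potentials and balanced joins *)

Section Joins.
Variables (V E : finType) (inc : V -> E -> bool).
Hypothesis inc2 : forall e, #|[set v | inc v e]| = 2.
Local Notation bd := (odd_degree inc).
Local Notation adj := (adjacent inc).

(* The empty sequence when [a] and [b] are not joined by an edge. *)
Definition edge_seq a b : seq E := if [pick e | inc a e && inc b e] is Some e then [:: e] else [::].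

Lemma edge_seqP a b : adj a b -> exists e, [/\ edge_seq a b = [:: e], inc a e, inc b e & a != b].
Proof.
move=> /andP[ab /existsP[e eab]]; rewrite /edge_seq; case: pickP => [e' /andP[]|/(_ e)].
  by exists e'.
by rewrite eab.
Qed.

Lemma adjC a b : adj a b = adj b a.
Proof. by rewrite /adjacent eq_sym; congr (_ && _); apply: eq_existsb => e; rewrite andbC. Qed.

Lemma odd_degree_edge_seq a b v : adj a b -> bd (edge_seq a b) v = (v == a) (+) (v == b).
Proof. by move=> /edge_seqP[e [-> ae be ab]]; rewrite odd_degree_cons (incX inc2 v ae be ab) addbF. Qed.

(* The current edge of the walk is kept when the flag [c] is set, and the flag flips
   at the vertices satisfying [q]; hence the inner vertices of odd degree in the
   selection are those satisfying [q]. *)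
Fixpoint select (q : pred V) c w s : seq E :=
  if s is a :: s' then (if c then edge_seq w a else [::]) ++ select q (c (+) q a) a s' else [::].

Definition select_end (q : pred V) c s : bool := c (+) \big[addb/false]_(a <- s) q a.

Lemma select_rcons q c w s z :
  select q c w (rcons s z) = select q c w s ++ (if select_end q c s then edge_seq (last w s) z else [::]).
Proof.
elim: s c w => [|a s IHs] c w; rewrite /select_end /= ?big_nil ?addbF ?cats0 //.
by rewrite IHs big_cons /select_end addbA catA.
Qed.

Lemma odd_degree_select q c w s v : path adj w s ->
  bd (select q c w s) v = c && (v == w) (+) \big[addb/false]_(a <- s) ((v == a) && q a)
                       (+) select_end q c s && (v == last w s).
Proof.
elim: s c w => [|a s IHs] c w /=.
  by move=> _; rewrite /select_end !big_nil !addbF addbb.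
move=> /andP[wa pas]; rewrite odd_degree_cat IHs //.
have -> : bd (if c then edge_seq w a else [::]) v = c && ((v == w) (+) (v == a)).
  by case: c; rewrite ?odd_degree_edge_seq.
rewrite big_cons /select_end big_cons addbA; case: c; case: (v == w); case: (v == a); case: (q a) => //=;
  by rewrite ?addbF ?addbT ?addFb ?addTb ?negbK.
Qed.

(** The opposite initial flag selects precisely the complementary edges. *)
Lemma size_selectC q c w s : path adj w s ->
  size (select q c w s) + size (select q (~~ c) w s) = size s.
Proof.
elim: s c w => //= a s IHs c w /andP[/edge_seqP[e [-> _ _ _]] /(IHs (c (+) q a))].
by rewrite !size_cat addNb; case: c => /= <-; lia.
Qed.

Lemma size_select_all (q : pred V) c w s z : path adj w (rcons s z) -> all q s ->
  size (select q c w (rcons s z)) = (size s + 1 + c)./2.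
Proof.
elim: s c w => [|a s IHs] c w /=.
  by case/andP=> /edge_seqP[e [-> _ _ _]] _ _; case: c.
case/andP=> /edge_seqP[e [-> _ _ _]] pas /andP[-> qs]; rewrite size_cat IHs // addbT.
by case: c => /=; lia.
Qed.

Lemma all_select (p : pred E) q c w s :
  path (fun a b => all p (edge_seq a b)) w s -> all p (select q c w s).
Proof.
elim: s c w => //= a s IHs c w /andP[pwa /IHs]; rewrite all_cat => ->.
by case: c; rewrite ?pwa.
Qed.

Variable phi : E -> bool.

(* The failure of [phi] to be the coboundary of [pi] at the edge [e]. *)
Definition defect (pi : V -> bool) e : bool :=
  phi e (+) \big[addb/false]_(v | inc v e) pi v.

Lemma defectE pi e a b : inc a e -> inc b e -> a != b ->
  defect pi e = phi e (+) pi a (+) pi b.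
Proof.
move=> ae be ab; rewrite /defect -addbA; congr (_ (+) _).
rewrite (bigD1 a) //= (big_pred1 b) // => v.
by rewrite (incE inc2 v ae be ab) /=; case: (eqVneq v a) => [->|] /=; rewrite ?(negPf ab) ?andbT.
Qed.

(** The correction depends only on the vertices of odd degree, so [phi] may be replaced by its
    defect when joins with equal boundary are compared. *)
Lemma parity_defect pi L :
  parity (defect pi) L = parity phi L (+) \big[addb/false]_v (pi v && bd L v).
Proof.
elim: L => [|e L IHL]; first by rewrite big1 // => v _; rewrite andbF.
rewrite !parity_cons IHL {1}/defect big_mkcond /= addbACA -big_split /=.
congr (_ (+) _); apply: eq_bigr => v _; rewrite odd_degree_cons.
by case: (inc v e); case: (pi v).
Qed.

Lemma parity_defect0 pi L : all (fun e => ~~ defect pi e) L -> parity (defect pi) L = false.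
Proof.
move=> aL; rewrite /parity (@eq_in_count _ _ pred0) ?count_pred0 // => e /(allP aL)/negPf.
by [].
Qed.

(** The edges of the path fix the values on [s] one after another; no vertex is assigned twice,
    since the path does not repeat vertices. *)
Lemma ear_potential pi w s : path adj w s -> uniq (w :: s) -> exists pi' : V -> bool,
  (forall v, v \notin s -> pi' v = pi v) /\
  path (fun a b => all (fun e => ~~ defect pi' e) (edge_seq a b)) w s.
Proof.
elim: s w pi => [|a s IHs] w pi; first by exists pi.
rewrite /= inE negb_or => /andP[wa pas] /and3P[/andP[neq_wa ws] as_ us].
have [e [ewa we ae _]] := edge_seqP wa.
have [|pi' [piE pi'P]] := IHs a (fun v => if v == a then phi e (+) pi w else pi v) pas.
  by rewrite /= as_.
exists pi'; split=> [v|].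
  by rewrite inE negb_or => /andP[va vs]; rewrite piE // (negPf va).
rewrite pi'P andbT ewa /= andbT (defectE _ we ae neq_wa) !piE // eqxx (negPf neq_wa).
by case: (phi e); case: (pi w).
Qed.

Definition balanced_in pi (X : {set V}) e := ([set v | inc v e] \subset X) && ~~ defect pi e.

(* The sizes of the joins are those of near-perfect matchings.  For [y = u] the join is
   a matching of [X] minus [x]; otherwise it may have one vertex of degree 3, counting
   the half-edges at [u], [x] and [y]. *)
Definition blob (u : V) pi (X : {set V}) i :=
  #|X| = i.*2.+1 /\ forall x y, x \in X -> y \in X -> exists L,
   [/\ all (balanced_in pi X) L,
       forall v, bd L v = (v \in X) (+) (v == u) (+) (v == x) (+) (v == y)
     & size L <= i].

Lemma balanced_in_sub pi pi' (X X' : {set V}) e : X \subset X' -> {in X, pi' =1 pi} ->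
  balanced_in pi X e -> balanced_in pi' X' e.
Proof.
move=> sX piE /andP[eX de]; rewrite /balanced_in (subset_trans eX sX) /=.
suff -> : defect pi' e = defect pi e by [].
rewrite /defect; congr (_ (+) _); apply: eq_bigr => v ve.
by apply: piE; apply: (subsetP eX); rewrite inE.
Qed.

(* Along an ear with [2j+1] edges, the selections with given odd inner vertices are
   two complementary ones, so one of them has at most [j] edges.  Comparing the two
   alternating selections, completed outside the ear, shows that the last edge of the
   ear is balanced as well. *)
Lemma blob_ear (u w z : V) pi (X : {set V}) i s j (K : {set V}) k :
    blob u pi X i -> u \in X -> w \in X -> z \in X -> X \subset K ->
    path adj w (rcons s z) -> uniq s -> {subset s <= K :\: X} -> size s = j.*2 ->
    #|K| = k.*2.+1 -> matchable inc (K :\: (X :|: [set v in s])) ->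
    (forall L L', (forall v, bd L v = (v \in K :\ u)) -> (forall v, bd L' v = (v \in K :\ u)) ->
       size L <= k.+1 -> size L' <= k.+1 -> parity phi L = parity phi L') ->
  exists pi', blob u pi' (X :|: [set v in s]) (i + j).
Proof.
move=> [cX joinX] uX wX zX sXK pathw us sub sz cK [R [bdR sR]] const.
have [pw az] : path adj w s /\ adj (last w s) z.
  by move: pathw; rewrite rcons_path => /andP[].
have sX v : v \in s -> v \notin X by move/sub; rewrite inE => /andP[].
have Xs v : v \in X -> v \notin s by apply: contraL; apply: sX.
have sK v : v \in s -> v \in K by move/sub; rewrite inE => /andP[].
have [pi' [piE pathpi]] : exists pi' : V -> bool,
    (forall v, v \notin s -> pi' v = pi v) /\
    path (fun a b => all (fun e => ~~ defect pi' e) (edge_seq a b)) w s.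
  by apply: ear_potential; rewrite //= us Xs.
set X' := X :|: [set v in s] in bdR sR *.
have inX' v : v \in X' = (v \in X) (+) (v \in s).
  by rewrite !inE; case: (boolP (v \in X)) => //= /Xs/negPf->.
have goodX' e : balanced_in pi X e -> balanced_in pi' X' e.
  by apply: balanced_in_sub; [exact: subsetUl | move=> v /Xs/piE].
have [e [ezE ae ze ne_az]] := edge_seqP az.
have selE q c : select q c w (rcons s z) = select q c w s ++ (if select_end q c s then [:: e] else [::]).
  by rewrite select_rcons ezE.
have cX' : #|X'| = (i + j).*2.+1.
  rewrite cardsU (_ : X :&: [set v in s] = set0); last first.
    by apply/setP=> v; rewrite !inE; apply/negP=> /andP[/Xs/negPf->].
  by rewrite cX cards0 subn0 cardsE (card_uniqP us) sz doubleD.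
have sX'K : X' \subset K.
  by rewrite subUset sXK; apply/subsetP=> v; rewrite inE => /sK.
have pair_sum v : \big[addb/false]_(a <- s) (v == a) = (v \in s).
  elim: s us {sz pathw sub pw az sX Xs sK piE pathpi X' bdR sR inX' goodX' selE cX' sX'K ae ne_az ezE}
    => [|a s IHs] /=; first by rewrite big_nil.
  move=> /andP[as_ us]; rewrite big_cons inE IHs //.
  by case: (eqVneq v a) => [->|] /=; rewrite ?(negPf as_).
have sum_q q v : \big[addb/false]_(a <- s) ((v == a) && q a) = (v \in s) && q v.
  rewrite -pair_sum big_distrl /=; apply: eq_bigr => a _.
  by case: eqP => // ->.
have bdsel q c v : (forall a, a \in X -> q a = false) ->
    bd (select q c w (rcons s z)) v =
    c && (v == w) (+) (v \in s) && q v (+) select_end q c s && (v == z).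
  move=> q0; rewrite odd_degree_select // last_rcons -cats1 big_cat big_seq1 /= sum_q (q0 z zX).
  by rewrite /select_end big_cat big_seq1 /= (q0 z zX) andbF !addbF.
have fin_s : \big[addb/false]_(a <- s) (a \in s) = false.
  rewrite big_seq_cond (eq_bigr (fun=> true)) => [|a /andP[->] //].
  rewrite -big_seq_cond; have -> : \big[addb/false]_(a <- s) true = odd (size s).
    by elim: (s) => [|a t IHt]; rewrite ?big_nil // big_cons IHt.
  by rewrite sz odd_double.
have facts v : [&& (v \in X) ==> (v \in K), (v \in X) ==> ~~ (v \in s), (v \in s) ==> (v \in K)
    & (v == u) ==> (v \in X)].
  apply/and4P; split; apply/implyP; [exact: (subsetP sXK) | exact: Xs | exact: sK | by move/eqP->].
(* [J1] and [J2] use the two alternating halves of the ear and the same [R]. Only [J1] contains [e],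
   and apart from [R] all their other edges are balanced; so equal parities mean that [e] is
   balanced too. *)
have de : ~~ defect pi' e.
  have [L1 [good1 bd1 size1]] := joinX w z wX zX.
  have [L2 [good2 bd2 size2]] := joinX u u uX uX.
  pose q v := v \in s.
  have q0 a : a \in X -> q a = false by move/Xs/negPf.
  have allq : all q s by apply/allP.
  have finq c : select_end q c s = c by rewrite /select_end fin_s addbF.
  set J1 := L1 ++ select q true w (rcons s z) ++ R.
  set J2 := L2 ++ select q false w (rcons s z) ++ R.
  have bdJ1 v : bd J1 v = (v \in K :\ u).
    rewrite !odd_degree_cat bd1 bdsel // bdR finq !inE /q; move: (facts v).
    by case: (v \in X); case: (v \in s); case: (v \in K); case: (v == u);
      case: (v == w); case: (v == z).
  have bdJ2 v : bd J2 v = (v \in K :\ u).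
    rewrite !odd_degree_cat bd2 bdsel // bdR finq !inE /q; move: (facts v).
    by case: (v \in X); case: (v \in s); case: (v \in K); case: (v == u).
  have same : parity (defect pi') J1 = parity (defect pi') J2.
    have sR' : size R + (i + j) <= k.
      move: sR; have := cardsID X' K; rewrite (setIidPr sX'K) cK cX'.
      by clear; move: (size R) #|_ :\: _| => a b; lia.
    rewrite !parity_defect (const J1 J2) //; first 1 last.
    - rewrite !size_cat size_select_all // sz.
      by move: sR' size1; clear; move: (size R) (size L1) => a b; lia.
    - rewrite !size_cat size_select_all // sz.
      by move: sR' size2; clear; move: (size R) (size L2) => a b; lia.
    by congr (_ (+) _); apply: eq_bigr => v _; rewrite bdJ1 bdJ2.
  have nd pi1 Y L : all (balanced_in pi1 Y) L -> all (fun e => ~~ defect pi1 e) L.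
    by apply: sub_all => e1 /andP[].
  have good2X L : all (balanced_in pi X) L -> parity (defect pi') L = false.
    by move=> gL; apply: parity_defect0; apply: (@nd _ X'); apply: sub_all gL.
  move: same; rewrite /J1 /J2 !parity_cat (good2X L1) // (good2X L2) // !selE !finq !parity_cat.
  rewrite (parity_defect0 (all_select q true pathpi)) (parity_defect0 (all_select q false pathpi)) /=.
  by rewrite parity_cons /= addbF; case: (defect pi' e); case: (parity _ R).
exists pi'; split=> // x y xX' yX'.
(* The inner vertices of the ear are to be odd, except [x] and [y], which cancel when [x = y]. *)
pose q v := (v \in s) && ~~ ((v == x) (+) (v == y)).
have q0 a : a \in X -> q a = false by rewrite /q => /Xs/negPf->.
have finq c : select_end q c s = c (+) (x \in s) (+) (y \in s).
  rewrite /select_end -addbA; congr (_ (+) _).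
  rewrite (eq_big_seq (fun a => (a \in s) (+) ((x == a) (+) (y == a)))) => [|a as_].
    by rewrite !big_split /= fin_s !pair_sum.
  by rewrite /q as_ (eq_sym a x) (eq_sym a y).
have in_sel c : all (fun e => [set v | inc v e] \subset X') (select q c w (rcons s z)).
  apply: all_select; have wX' : w \in X' by rewrite inX' wX (negPf (Xs w wX)).
  have sX' : all (mem X') (rcons s z).
    rewrite all_rcons; apply/andP; split; first by rewrite !inE zX.
    by apply/allP=> v vs; rewrite !inE vs orbT.
  clear -inc2 pathw sX' wX'.
  elim: (rcons s z) w wX' pathw sX' => //= a t IHt b bX' /andP[ba pt] /andP[aX' tX'].
  rewrite IHt // andbT; have [e1 [-> be1 ae1 ab]] := edge_seqP ba; rewrite /= andbT.
  apply/subsetP=> v; rewrite inE (incE inc2 v be1 ae1 ab).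
  by case/orP=> /eqP->.
have good_sel c : all (balanced_in pi' X') (select q c w (rcons s z)).
  rewrite (eq_all (a2 := predI (fun e => [set v | inc v e] \subset X') (fun e => ~~ defect pi' e))) //.
  rewrite all_predI in_sel /= selE all_cat all_select //=.
  by case: select_end; rewrite /= ?de.
have finish c p t : p \in X -> t \in X -> size (select q c w (rcons s z)) <= j ->
    (forall v, (v == p) (+) (v == t) (+) c && (v == w) (+) (v \in s) && q v
               (+) (c (+) (x \in s) (+) (y \in s)) && (v == z)
             = (v \in s) (+) (v == x) (+) (v == y)) ->
    exists L, [/\ all (balanced_in pi' X') L,
      forall v, bd L v = (v \in X') (+) (v == u) (+) (v == x) (+) (v == y) & size L <= i + j].
  move=> pX tX sj E1; have [L [gL bL sL]] := joinX p t pX tX.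
  exists (L ++ select q c w (rcons s z)); split=> [|v|].
  - by rewrite all_cat good_sel andbT; apply: sub_all gL.
  - rewrite odd_degree_cat bL bdsel // finq inX'; move: (E1 v).
    move: (v \in X) (c && _) => b5 b2; move: (_ && (v == z)) => b1.
    move: (_ && q v) => b3; move: (v \in s) => b4.
    move: (v == p) (v == t) (v == x) (v == y) (v == u).
    by case: b1; case: b2; case: b3; case: b4; case: b5; do 5 case.
  - by rewrite size_cat leq_add.
(* The two selections share the [j.*2.+1] edges of the ear, so one of them has at most [j]. *)
have [c sc] : exists c, size (select q c w (rcons s z)) <= j.
  have := size_selectC q false pathw; rewrite size_rcons sz /= => sumj.
  have [le|gt] := leqP (size (select q false w (rcons s z))) j; first by exists false.
  exists true; move: sumj gt; move: (size _) (size _) => a b; clear; lia.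
have fx v : (v == x) ==> ((v \in s) == (x \in s)) by apply/implyP=> /eqP->.
have fy v : (v == y) ==> ((v \in s) == (y \in s)) by apply/implyP=> /eqP->.
have inXs v : v \in X' -> v \notin s -> v \in X by rewrite inX' => vX' /negPf vs; rewrite vs addbF in vX'.
(* The selection has an end at [w] if [c] holds, and at [z] if [c (+) (x \in s) (+) (y \in s)] does.
   The join in [X] takes these ends in place of those of [x] and [y] that lie on the ear, or [u]
   twice if no end remains. *)
have [xs|xs] := boolP (x \in s); have [ys|ys] := boolP (y \in s).
- apply: (finish c (if c then w else u) (if c then z else u)); rewrite ?xs ?ys //; try by case: (c).
  move=> v; move: (fx v) (fy v); rewrite xs ys /q.
  by case: (c); case: (v \in s); case: (v == x); case: (v == y); case: (v == w); case: (v == z);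
    case: (v == u).
- have yX := inXs y yX' ys.
  apply: (finish c y (if c then w else z)); rewrite ?xs ?(negPf ys) //; try by case: (c).
  move=> v; move: (fx v) (fy v); rewrite xs (negPf ys) /q.
  by case: (c); case: (v \in s); case: (v == x); case: (v == y); case: (v == w); case: (v == z).
- have xX := inXs x xX' xs.
  apply: (finish c x (if c then w else z)); rewrite ?ys ?(negPf xs) //; try by case: (c).
  move=> v; move: (fx v) (fy v); rewrite ys (negPf xs) /q.
  by case: (c); case: (v \in s); case: (v == x); case: (v == y); case: (v == w); case: (v == z).
(* Here the flag flips at every inner vertex; starting with [false], the selection has [j] edges and
   avoids the first and last edge of the ear. *)
- apply: (finish false x y); [exact: inXs | exact: inXs | |].
    rewrite size_select_all // ?sz; first by rewrite addn0 addn1 /= uphalf_double.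
    apply/allP=> v vs; rewrite /q vs; have [-> ->] : v == x = false /\ v == y = false.
      by split; [apply: contraTF vs | apply: contraTF vs] => /eqP->.
    by [].
  move=> v; move: (fx v) (fy v); rewrite (negPf xs) (negPf ys) /q.
  by case: (v \in s); case: (v == x); case: (v == y); case: (v == w); case: (v == z).
Qed.

End Joins.

Section Joins.
Variables (V E : finType) (inc : V -> E -> bool).
Hypothesis inc2 : forall e, #|[set v | inc v e]| = 2.
Local Notation bd := (odd_degree inc).
Local Notation adj := (adjacent inc).
Variable phi : E -> bool.

(** Ears of odd length extend [[set u]] to all of [K]. An edge of [K] together with the join for its
    two ends then has the same boundary as the join for [u] and [u], and comparing parities shows
    that the edge is balanced. *)
Theorem critical_balanced (K : {set V}) u k : #|K| = k.*2.+1 -> u \in K ->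
    (forall x, x \in K -> matchable inc (K :\ x)) ->
    (forall L L', (forall v, bd L v = (v \in K :\ u)) -> (forall v, bd L' v = (v \in K :\ u)) ->
       size L <= k.+1 -> size L' <= k.+1 -> parity phi L = parity phi L') ->
  exists pi, forall e, [set v | inc v e] \subset K -> ~~ defect inc phi pi e.
Proof.
move=> cK uK crit const.
have [N NP] := crit u uK; have [n [nK nV nW nN]] := mate_exists inc2 NP.
have nu : n u = u by rewrite nV // !inE eqxx.
suff [pi [_ joinK]] : exists pi, blob inc phi u pi K k.
  exists pi => e eK; have [a ae] := inc_exists inc2 e.
  have [b be ab] := inc_other inc2 ae.
  have [aK bK] : a \in K /\ b \in K by split; apply: (subsetP eK); rewrite inE.
  have [L [gL bL sL]] := joinK a b aK bK; have [L' [gL' bL' sL']] := joinK u u uK uK.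
  have nd Y : all (balanced_in inc phi pi K) Y -> parity (defect inc phi pi) Y = false.
    by move=> gY; apply: parity_defect0; apply: sub_all gY => f /andP[].
  have uv v : (v == u) ==> (v \in K) by apply/implyP=> /eqP->.
  have b1 v : bd (e :: L) v = (v \in K :\ u).
    rewrite odd_degree_cons bL (incX inc2 v ae be ab) !inE; move: (uv v).
    by case: (v \in K); case: (v == u); case: (v == a); case: (v == b).
  have b2 v : bd L' v = (v \in K :\ u).
    by rewrite bL' !inE; move: (uv v); case: (v \in K); case: (v == u).
  have : parity (defect inc phi pi) (e :: L) = parity (defect inc phi pi) L'.
    rewrite !parity_defect (const (e :: L) L') //; last exact: leqW.
    by congr (_ (+) _); apply: eq_bigr => v _; rewrite b1 b2.
  by rewrite parity_cons !nd // addbF => ->.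
suff grow m (X : {set V}) pi i : #|K| - #|X| <= m -> u \in X -> X \subset K ->
    (forall v, v \in X -> n v \in X) -> blob inc phi u pi X i -> exists pi', blob inc phi u pi' K k.
  apply: (grow _ [set u] (fun=> false) 0 (leqnn _)); rewrite ?inE ?sub1set //.
    by move=> v; rewrite inE => /eqP->; rewrite nu inE.
  split=> [|x y]; first by rewrite cards1.
  rewrite !inE => /eqP-> /eqP->; exists [::]; split=> // v.
  by rewrite inE; case: (v == u).
elim: m X pi i => [|m IHm] X pi i leKX uX sXK nX BX;
    (have [XK|neKX] := eqVneq X K; first by
      exists pi; have BK := BX; rewrite XK in BK; have := BK.1; rewrite cK => -[/double_inj->]);
  have pXK : X \proper K by rewrite properEneq neKX.
  by have := proper_card pXK; rewrite -subn_gt0 ltnNge leKX.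
have [y0 y0K y0X] : exists2 y0, y0 \in K & y0 \notin X.
  by case/properP: pXK => _ [y0 ? ?]; exists y0.
have ear y (yK : y \in K) (yX : y \notin X) : exists s z j,
    [/\ z \in X /\ path adj y (rcons s z), uniq (y :: s),
     {subset y :: s <= K :\: X}, (size s).+1 = j.*2
     & forall v, v \in y :: s -> n v \in y :: s].
  have [N' NP'] := crit y yK.
  have := ear_to inc2 NP NP' nK nV nW nX uX uK yK yX; exact.
(* An ear from any vertex outside [X] enters [X] by an edge from [y] to [w]. A second ear, started
   at [y] and preceded by this edge, has both ends in [X]. *)
have [y [w [yK yX wX wy]]] : exists y w, [/\ y \in K, y \notin X, w \in X & adj w y].
  have [s [z [j [[zX pz] _ sub _ _]]]] := ear y0 y0K y0X.
  have := sub (last y0 s) (mem_last _ _); rewrite inE => /andP[lX lK].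
  exists (last y0 s), z; split=> //; rewrite adjC.
  by move: pz; rewrite rcons_path => /andP[].
have [s [z [j [[zX pz] us sub sz nys]]]] := ear y yK yX.
have {}pz : path adj w (rcons (y :: s) z) by rewrite /= wy.
have sX' : X :|: [set v in y :: s] \subset K.
  by rewrite subUset sXK; apply/subsetP=> v; rewrite inE => /sub; rewrite inE => /andP[].
have nX' v : v \in X :|: [set v in y :: s] -> n v \in X :|: [set v in y :: s].
  rewrite !in_setU => /orP[/nX->//|]; rewrite in_set => /nys nv.
  by rewrite in_set nv orbT.
(* The rest of [K] is closed under [n], so the edges of [N] inside it match it. *)
have [|pi' BX'] := blob_ear inc2 BX uX wX zX sXK pz us sub sz cK _ const.
  apply: (near_perfect_sub inc2 NP nN) => [|v].
    apply/subsetP=> v; rewrite in_setD in_setD1 => /andP[vX ->]; rewrite andbT.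
    by apply: contraNneq vX => ->; rewrite in_setU uX.
  rewrite !in_setD => /andP[vX' vK]; apply/andP; split.
    by apply: contra vX' => /nX'; rewrite nK.
  have : v \in K :\ u.
    by rewrite in_setD1 vK andbT; apply: contraNneq vX' => ->; rewrite in_setU uX.
  by move=> /nW/andP[]; rewrite inE => /andP[].
apply: (IHm _ pi' _ _ _ sX' nX' BX'); last by rewrite in_setU uX.
have : #|X| < #|X :|: [set v in y :: s]|.
  apply: proper_card; apply/properP; split; first exact: subsetUl.
  by exists y => //; rewrite !inE eqxx orbT.
by move: leKX; move: #|X| #|K| #|_ :|: _| => a b c; clear; lia.
Qed.

End Joins.

(** * Bridgeless cubic graphs *)

Section Fibres.
Variables (I E : finType) (p : E -> I).

Lemma fibre_sum (E0 : {set E}) (A : {set I}) :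
  \sum_(i in A) #|[set e in E0 | p e == i]| = #|[set e in E0 | p e \in A]|.
Proof.
rewrite -[RHS]sum1_card (partition_big p (mem A)) /= => [|e]; last by rewrite inE => /andP[].
apply: eq_bigr => i iA; rewrite -sum1_card; apply: eq_bigl => e; rewrite !inE.
by case: eqP => [->|]; rewrite ?iA ?andbT ?andbF.
Qed.

End Fibres.

(** * Regular bipartite multigraphs *)

Section Regular.
Variables (I J E : finType) (p : E -> I) (b : E -> J).

(** Edges carry an end map to either side, so that parallel edges are possible, as they arise by
    contracting components. *)
Definition regular k (P : {set I}) (B : {set J}) (E0 : {set E}) :=
  [/\ forall e, e \in E0 -> (p e \in P) && (b e \in B),
      forall i, i \in P -> #|[set e in E0 | p e == i]| = k
    & forall j, j \in B -> #|[set e in E0 | b e == j]| = k].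

(** The [k.+1] edges at each vertex of a set [A'] end in its neighbours, which have only [k.+1]
    edges each; this is Hall's condition. Removing the perfect matching lowers every degree by
    one. *)
Lemma regular_sdr k P B (E0 : {set E}) (e0 : E) : regular k.+1 P B E0 -> exists g : I -> E,
  [/\ forall i, i \in P -> (g i \in E0) /\ p (g i) = i,
      {in P &, injective (b \o g)}
    & regular k P B (E0 :\: [set g i | i in P])].
Proof.
move=> [endP fibP fibB].
pose R i j := [exists e in E0, (p e == i) && (b e == j)].
have [A' sA'|f fI fR] := @hall I J R (b e0) P B.
  rewrite -(leq_pmul2r (ltn0Sn k)) -!sum_nat_const.
  rewrite -(eq_bigr _ (fun i iA => fibP i (subsetP sA' i iA))).
  have NB j : j \in nbrs R B A' -> j \in B by rewrite inE => /andP[].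
  rewrite -(eq_bigr _ (fun j jN => fibB j (NB j jN))) !fibre_sum.
  apply: subset_leq_card; apply/subsetP=> e; rewrite !inE => /andP[eE peA].
  rewrite eE (proj2 (andP (endP e eE))) /=; apply/exists_inP; exists (p e) => //.
  by apply/exists_inP; exists e; rewrite ?eqxx.
have ch i : exists e, i \in P -> [/\ e \in E0, p e = i & b e = f i].
  have [iP|_] := boolP (i \in P); last by exists e0.
  by have /andP[_ /exists_inP[e eE /andP[/eqP pe /eqP be]]] := fR i iP; exists e.
have [g gP] := fin_all_exists ch.
have pg i : i \in P -> p (g i) = i by move=> /gP[].
have gI : {in P &, injective g} by move=> i j iP jP E1; rewrite -(pg i iP) -(pg j jP) E1.
have bI : {in P &, injective (b \o g)}.
  by move=> i j iP jP /=; have [_ _ ->] := gP i iP; have [_ _ ->] := gP j jP; apply: fI.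
exists g; split=> // [i /gP[]//|].
have cPB : #|P| = #|B|.
  have sumE (K : finType) (q : E -> K) (Q : {set K}) :
      (forall e, e \in E0 -> q e \in Q) ->
      (forall i, i \in Q -> #|[set e in E0 | q e == i]| = k.+1) -> #|Q| * k.+1 = #|E0|.
    move=> qE qQ; rewrite -sum_nat_const -(eq_bigr _ qQ) fibre_sum.
    by congr #|pred_of_set _|; apply/setP=> e; rewrite !inE; apply: andb_idr => /qE.
  apply/eqP; rewrite -(eqn_pmul2r (ltn0Sn k)) (sumE _ p P) ?(sumE _ b B) //.
    by move=> e /endP/andP[].
  by move=> e /endP/andP[].
have imB : B = [set (b \o g) i | i in P].
  apply/esym/eqP; rewrite eqEcard card_in_imset // cPB leqnn andbT.
  by apply/subsetP=> _ /imsetP[i iP ->] /=; have [/endP/andP[]] := gP i iP.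
have drop (a : pred E) e : a e -> e \in E0 -> e \in [set g i | i in P] ->
    (forall i, i \in P -> a (g i) -> g i = e) -> #|[set e in E0 | a e]| = k.+1 ->
    #|[set e in E0 :\: [set g i | i in P] | a e]| = k.
  move=> ae eE eg uni; rewrite (cardsD1 e) !inE eE ae => -[<-].
  congr #|pred_of_set _|; apply/setP=> e'; rewrite !inE.
  have [->|ne] := eqVneq e' e; first by rewrite eg.
  case: (boolP (e' \in _)) => // /imsetP[i iP eqe].
  by case: (boolP (a e')); rewrite /= ?andbF // => ae'; move: ne; rewrite eqe uni -?eqe ?eqxx.
split=> [e|i iP|j jB].
- by rewrite inE => /andP[_ /endP].
- have [gE pgi _] := gP i iP; apply: (drop (fun e => p e == i) (g i)); rewrite ?pgi ?fibP ?imset_f //.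
  by move=> i' i'P; rewrite pg // => /eqP->.
- have : j \in [set (b \o g) i | i in P] by rewrite -imB.
  case/imsetP=> i iP jE; have [gE _ _] := gP i iP.
  apply: (drop (fun e => b e == j) (g i)); rewrite ?jE ?eqxx ?imset_f //; last by rewrite -jE fibB.
  by move=> i' i'P /eqP/(bI _ _ i'P iP)->.
Qed.

End Regular.

Section SetOfSeq.
Variable E : finType.

Lemma parity_odd_set (L : seq E) (a : pred E) :
  parity a L = odd #|[set e in [set e | odd (count_mem e L)] | a e]|.
Proof.
rewrite -xor_card (eq_bigr (fun e => odd (count_mem e L) && a e)) => [|e _]; last by rewrite inE.
elim: L => [|x L IHL]; first by rewrite big1.
rewrite parity_cons IHL [RHS](eq_bigr (fun e => (x == e) && a e (+) odd (count_mem e L) && a e)).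
  rewrite big_split /=; congr (_ (+) _); rewrite (bigD1 x) //= eqxx big1 ?addbF // => e.
  by rewrite eq_sym => /negPf->.
by move=> e _; rewrite oddD oddb andb_addl.
Qed.

Lemma card_odd_set (L : seq E) : #|[set e | odd (count_mem e L)]| <= size L.
Proof.
apply: leq_trans (card_size L); apply: subset_leq_card; apply/subsetP=> e; rewrite inE.
by rewrite -has_pred1 has_count; case: count.
Qed.

End SetOfSeq.

(** * Cuts and barriers in bridgeless cubic graphs *)

Section Cubic.
Variables (V E : finType) (inc : V -> E -> bool).
Hypothesis inc2 : forall e, #|[set v | inc v e]| = 2.
Definition cut (S : {set V}) : {set E} :=
  [set e | [exists u in S, inc u e] && [exists v in ~: S, inc v e]].

Lemma cutP (S : {set V}) e :
  reflect (exists u v, [/\ u \in S, v \notin S, inc u e & inc v e]) (e \in cut S).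
Proof.
rewrite inE; apply: (iffP andP) => [[/exists_inP[u uS ue] /exists_inP[v]]|[u [v [uS vS ue ve]]]].
  by rewrite inE => vS ve; exists u, v.
by split; apply/exists_inP; [exists u | exists v; rewrite ?inE].
Qed.

Lemma odd_inc_cut (S : {set V}) e : odd #|[set v in S | inc v e]| = (e \in cut S).
Proof.
have [a ae] := inc_exists inc2 e.
have [b be ab] := inc_other inc2 ae.
have -> : [set v in S | inc v e] = [set v in [set a; b] | v \in S].
  by apply/setP=> v; rewrite !inE (incE inc2 v ae be ab) andbC.
have -> : #|[set v in [set a; b] | v \in S]| = (a \in S) + (b \in S).
  rewrite -sum1_card (eq_bigl (fun v => (v \in [set a; b]) && (v \in S))) => [|v]; last by rewrite inE.
  rewrite big_mkcondr big_setU1 ?inE // big_set1.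
  by case: (a \in S); case: (b \in S).
rewrite oddD !oddb.
have exE (A : {set V}) : [exists v in A, inc v e] = (a \in A) || (b \in A).
  apply/exists_inP/orP => [[v vA]|[aA|bA]]; [|by exists a|by exists b].
  by rewrite (incE inc2 v ae be ab) => /orP[]/eqP<-; [left|right].
rewrite in_set !exE !inE.
by case: (a \in S); case: (b \in S).
Qed.

Hypothesis inc3 : forall v, #|[set e | inc v e]| = 3.

(** Both sides have the parity of the number of incidences at [S]: all degrees are odd, and an edge
    contributes an odd number exactly when it is in the cut. *)
Lemma odd_cut S : odd #|cut S| = odd #|S|.
Proof.
have -> : odd #|S| = odd (\sum_(v in S) #|[set e | inc v e]|).
  by rewrite (eq_bigr (fun=> 3)) ?sum_nat_const ?oddM ?andbT.
have -> : \sum_(v in S) #|[set e | inc v e]| = \sum_e #|[set v in S | inc v e]|.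
  rewrite (eq_bigr (fun v => \sum_e (inc v e : nat))) => [|v _]; last first.
    by rewrite -sum1_card big_mkcond; apply: eq_bigr => e _; rewrite inE; case: inc.
  rewrite exchange_big; apply: eq_bigr => e _; rewrite -sum1_card big_mkcond /= [RHS]big_mkcond.
  by apply: eq_bigr => v _; rewrite inE; case: (v \in S); case: inc.
rewrite -sum1_card !(big_morph odd oddD (erefl (odd 0))) big_mkcond; apply: eq_bigr => e _.
by rewrite odd_inc_cut; case: ifP.
Qed.

Hypothesis bridgeless : forall S, #|cut S| != 1.

Lemma cut_ge3 (S : {set V}) : odd #|S| -> 3 <= #|cut S|.
Proof. by rewrite -odd_cut; have := bridgeless S; case: #|cut S| => [|[|[]]]. Qed.

Section Barrier.
Variables (v0 : V) (B : {set V}) (P : {set {set V}}).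
Hypothesis famP : odd_family inc setT B P.

Definition end_in e := odflt v0 [pick v | inc v e && (v \in B)].
Definition end_out e := odflt v0 [pick v | inc v e && (v \notin B)].

Lemma end_inP e : e \in cut B -> inc (end_in e) e /\ end_in e \in B.
Proof.
case/cutP=> u [_ [uB _ ue _]]; rewrite /end_in.
by case: pickP => [v /andP[]//|/(_ u)]; rewrite uB ue.
Qed.

Lemma end_outP e : e \in cut B -> inc (end_out e) e /\ end_out e \notin B.
Proof.
case/cutP=> _ [u [_ uB _ ue]]; rewrite /end_out.
by case: pickP => [v /andP[]//|/(_ u)]; rewrite uB ue.
Qed.

Lemma fibre_in_le b : b \in B -> #|[set e in cut B | end_in e == b]| <= 3.
Proof.
move=> bB; rewrite -(inc3 b); apply: subset_leq_card; apply/subsetP=> e.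
by rewrite in_set => /andP[eB /eqP <-]; rewrite inE; have [] := end_inP eB.
Qed.

Lemma fibre_out_ge S : S \in P -> 3 <= #|[set e in cut B | pblock P (end_out e) == S]|.
Proof.
move=> SP; have /odd_familyP[tP oP sP clP] := famP.
apply: leq_trans (cut_ge3 (oP S SP)) _; apply: subset_leq_card; apply/subsetP=> e.
case/cutP=> u [v [uS vS ue ve]].
have uB : u \notin B by have := subsetP (sP S SP) u uS; rewrite !inE andbT.
have vB : v \in B.
  apply: contraR vS => vB; have /closed_inP := clP S SP; apply; [exact: uS | | exact: ue | exact: ve].
  by rewrite !inE vB.
have eB : e \in cut B by apply/cutP; exists v, u.
rewrite in_set eB /=; have [oe oB] := end_outP eB.
have uv : u != v by apply: contraTneq vB => <-.
move: oe; rewrite (incE inc2 _ ue ve uv) => /orP[]/eqP E1.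
  by rewrite E1; apply/eqP/def_pblock.
by move: oB; rewrite E1 vB.
Qed.

Lemma fibre_out_sum :
  #|P| * 3 <= \sum_(S in P) #|[set e in cut B | pblock P (end_out e) == S]|.
Proof. by rewrite -sum_nat_const; apply: leq_sum => S; apply: fibre_out_ge. Qed.

Lemma fibre_in_sum : \sum_(b in B) #|[set e in cut B | end_in e == b]| <= #|B| * 3.
Proof. by rewrite -sum_nat_const; apply: leq_sum => b; apply: fibre_in_le. Qed.

(** Petersen's count: at least three edges leave each odd set, all of them towards [B], and a vertex
    of [B] receives at most three. *)
Lemma barrier_le : #|P| <= #|B|.
Proof.
rewrite -(@leq_pmul2r 3) //.
apply: leq_trans fibre_out_sum _; apply: leq_trans fibre_in_sum; rewrite !fibre_sum.
apply: subset_leq_card; apply/subsetP=> e; rewrite in_set => /andP[eB _].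
by rewrite in_set eB /=; have [] := end_inP eB.
Qed.

(** The count of [barrier_le] becomes an equality, hence is exact at every single set and vertex. *)
Lemma barrier_regular : #|P| = #|B| -> cover P = ~: B ->
  regular (fun e => pblock P (end_out e)) end_in 3 P B (cut B).
Proof.
move=> cPB covP.
have endP e : e \in cut B -> (pblock P (end_out e) \in P) && (end_in e \in B).
  move=> eB; have [_ oB] := end_outP eB; have [_ ->] := end_inP eB.
  by rewrite andbT pblock_mem // covP inE.
have sumP : \sum_(S in P) #|[set e in cut B | pblock P (end_out e) == S]| = #|cut B|.
  rewrite fibre_sum; congr #|pred_of_set _|; apply/setP=> e; rewrite in_set.
  by apply: andb_idr => /endP/andP[].
have sumB : \sum_(b in B) #|[set e in cut B | end_in e == b]| = #|cut B|.
  rewrite fibre_sum; congr #|pred_of_set _|; apply/setP=> e; rewrite in_set.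
  by apply: andb_idr => /endP/andP[].
have cB : #|cut B| = #|B| * 3.
  by apply/eqP; rewrite eqn_leq -{1}sumB fibre_in_sum -cPB -sumP fibre_out_sum.
split=> // [S SP|b bB]; apply/eqP.
  have [_] := leqif_sum (fun T TP => leqif_eq (@fibre_out_ge T TP)).
  by rewrite sumP cB -cPB sum_nat_const eqxx => /esym/forall_inP/(_ S SP); rewrite eq_sym.
have [_] := leqif_sum (fun c cB => leqif_eq (@fibre_in_le c cB)).
by rewrite sumB cB sum_nat_const eqxx => /esym/forall_inP/(_ b bB).
Qed.

End Barrier.

End Cubic.

Lemma count_enum (E : finType) (A : {set E}) (a : pred E) :
  count a (enum A) = #|[set e in A | a e]|.
Proof.
rewrite -size_filter [RHS]cardE /enum_mem -filter_predI; congr size; apply: eq_filter => e.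
by rewrite !inE andbC.
Qed.

Lemma count_enumT (E : finType) (a : pred E) : count a (enum E) = #|[set e | a e]|.
Proof.
rewrite -size_filter [RHS]cardE /enum_mem -filter_predI; congr size; apply: eq_filter => e.
by rewrite !inE andbT.
Qed.

Lemma parity_big (E : Type) (a : pred E) (s : seq E) : parity a s = \big[addb/false]_(e <- s) a e.
Proof. by elim: s => [|e s IHs]; rewrite ?big_nil // parity_cons IHs big_cons. Qed.

(** * Small joins with prescribed parity *)

Section Cubic.
Variables (V E : finType) (inc : V -> E -> bool).
Hypothesis inc2 : forall e, #|[set v | inc v e]| = 2.
Hypothesis inc3 : forall v, #|[set e | inc v e]| = 3.
Hypothesis bridgeless : forall S, #|cut inc S| != 1.
Local Notation bd := (odd_degree inc).

Lemma odd_degree_enum v : bd (enum E) v = true.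
Proof. by rewrite /odd_degree /parity count_enumT inc3. Qed.

(** The bound leaves room for one edge more than in a perfect matching; the comparison of joins in
    [critical_balanced] consumes it. *)
Theorem cubic_small_join (v0 : V) (phi : E -> bool) : exists L : seq E,
  [/\ forall v, bd L v, 2 * size L <= #|V| + 2 & parity phi L = parity phi (enum E)].
Proof.
pose ok (J : {set E}) := [&& [forall v, bd (enum J) v], 2 * #|J| <= #|V| + 2
  & parity phi (enum J) == parity phi (enum E)].
have [/existsP[J /and3P[/forallP bJ sJ /eqP pJ]]|/existsPn none] := boolP [exists J, ok J].
  by exists (enum J); rewrite -cardE.
have wrong L : (forall v, bd L v) -> 2 * size L <= #|V| + 2 -> parity phi L = ~~ parity phi (enum E).
  move=> bL sL; pose J := [set e | odd (count_mem e L)].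
  have parJ a : parity a (enum J) = parity a L.
    by rewrite [RHS]parity_odd_set /parity count_enum.
  have := none J; rewrite /ok parJ => /negbTE.
  have -> : [forall v, bd (enum J) v] by apply/forallP=> v; rewrite /odd_degree parJ; apply: bL.
  have -> : 2 * #|J| <= #|V| + 2.
    by apply: leq_trans sL; rewrite leq_mul2l card_odd_set.
  by move=> /= /eqP; case: parity; case: parity.
have [e0 _] : exists e0, e0 \in [set e | inc v0 e].
  by apply/card_gt0P; rewrite inc3.
have tT : tutte inc setT by move=> B P _; apply: barrier_le.
have [B [P [_ famP cPB covP crit]]] := tutte_barrier tT.
have covB : cover P = ~: B by rewrite covP setTD.
have reg3 := barrier_regular inc2 inc3 bridgeless v0 famP cPB covB.
have /odd_familyP[tP oP sP clP] := famP.
pose out := end_out inc v0 B; pose inn := end_in inc v0 B.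
pose p e := pblock P (out e).
have [g1 [g1P g1I reg2]] := regular_sdr e0 reg3.
have [g2 [g2P g2I reg1]] := regular_sdr e0 reg2.
have [g3 [g3P g3I reg0]] := regular_sdr e0 reg1.
have chN (Sx : {set V} * V) : exists N, Sx.1 \in P -> Sx.2 \in Sx.1 ->
    near_perfect inc (Sx.1 :\ Sx.2) N.
  case: (boolP (Sx.1 \in P)) => SP; last by exists [::].
  case: (boolP (Sx.2 \in Sx.1)) => xS; last by exists [::].
  by have [N NP] := tutte_matchable inc2 (crit _ _ SP xS); exists N.
have [N NP] := fin_all_exists chN.
have outS (g : {set V} -> E) S : (forall S, S \in P -> (g S \in cut inc B) /\ p (g S) = S) ->
    S \in P -> out (g S) \in S.
  move=> gP SP; have [gB pS] := gP S SP; have [oe oB] := end_outP v0 gB.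
  have : out (g S) \in p (g S) by rewrite mem_pblock covB inE.
  by rewrite pS.
(* A perfect matching [g] of the contracted graph, completed by [M] inside the sets, respects the
   size bound as long as the total excess is at most 2. *)
have sound (g : {set V} -> E) : (forall S, S \in P -> (g S \in cut inc B) /\ p (g S) = S) ->
    {in P &, injective (inn \o g)} -> forall (M : {set V} -> seq E) ex,
    (forall S v, S \in P -> bd (M S) v = (v \in S :\ out (g S))) ->
    (forall S, S \in P -> 2 * size (M S) + 1 <= #|S| + ex S) ->
    \sum_(S in P) ex S <= 2 ->
    parity phi (assemble P g M) = ~~ parity phi (enum E).
  move=> gP gI M ex bM sM sex; apply: wrong => [v|].
    rewrite (@odd_degree_assemble _ _ _ inc2 setT B P (inn \o g) g (out \o g)) ?inE ?subsetT //.
    - move=> S SP; have [gB _] := gP S SP.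
      by have [] := end_inP v0 gB.
    - move=> S SP; have [gB pS] := gP S SP.
      have [ie iB] := end_inP v0 gB; have [oe oB] := end_outP v0 gB; split=> //.
      exact: outS.
  rewrite -cardsT; apply: leq_trans (leq_add (leqnn _) sex).
  exact: (@size_assemble _ _ setT B P g M (subsetT _) tP covP cPB ex sM).
pose Ng (g : {set V} -> E) S := N (S, out (g S)).
have NgP (g : {set V} -> E) S : (forall S, S \in P -> (g S \in cut inc B) /\ p (g S) = S) ->
    S \in P -> near_perfect inc (S :\ out (g S)) (Ng g S).
  by move=> gP SP; apply: (NP (S, out (g S))) => //; apply: outS.
have sNg (g : {set V} -> E) S : (forall S, S \in P -> (g S \in cut inc B) /\ p (g S) = S) ->
    S \in P -> 2 * size (Ng g S) + 1 <= #|S|.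
  move=> gP SP; have [_ sN] := NgP g S gP SP.
  by rewrite (cardsD1 (out (g S)) S) outS // addnC leq_add2l.
have wrong_g (g : {set V} -> E) : (forall S, S \in P -> (g S \in cut inc B) /\ p (g S) = S) ->
    {in P &, injective (inn \o g)} -> parity phi (assemble P g (Ng g)) = ~~ parity phi (enum E).
  move=> gP gI; apply: (sound g gP gI _ (fun=> 0)) => [S v SP|S SP|].
  - by have [] := NgP g S gP SP.
  - by rewrite addn0 sNg.
  - by rewrite big1.
have g1P' S (SP : S \in P) : (g1 S \in cut inc B) /\ p (g1 S) = S := g1P S SP.
have g2P' S : S \in P -> (g2 S \in cut inc B) /\ p (g2 S) = S.
  by move=> /g2P[]; rewrite in_setD => /andP[].
have g3P' S : S \in P -> (g3 S \in cut inc B) /\ p (g3 S) = S.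
  by move=> /g3P[]; rewrite !in_setD => /and3P[].
have par_asm a g M : parity a (assemble P g M) = \big[addb/false]_(S in P) (a (g S) (+) parity a (M S)).
  by rewrite /assemble parity_flatten big_enum; apply: eq_bigr => S _; rewrite parity_cons.
have chpi (S : {set V}) : exists pi, S \in P ->
    forall e, [set v | inc v e] \subset S -> ~~ defect inc phi pi e.
  case: (boolP (S \in P)) => SP; last by exists (fun=> false).
  have cS : #|S| = (#|S|./2).*2.+1 by rewrite -[LHS]odd_double_half oP.
  have [||pi piP] := @critical_balanced _ _ inc inc2 phi S (out (g1 S)) _ cS (outS g1 S g1P' SP); last by exists pi.
    by move=> x xS; apply/tutte_matchable/crit.
  (* Only the part inside [S] changes, so the parity of [L] is determined by the rest. Spending the
     whole excess 2 on [S] allows the size [(#|S|./2).+1]. *)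
  have swap L : (forall v, bd L v = (v \in S :\ out (g1 S))) -> size L <= (#|S|./2).+1 ->
      parity phi L = ~~ parity phi (enum E) (+) (phi (g1 S) (+)
        \big[addb/false]_(T in P | T != S) (phi (g1 T) (+) parity phi (Ng g1 T))).
    move=> bL sL; rewrite -(sound g1 g1P' g1I (fun T => if T == S then L else Ng g1 T)
      (fun T => if T == S then 2 else 0)).
    - rewrite par_asm (bigD1 S) //= eqxx.
      rewrite (eq_bigr (fun T => phi (g1 T) (+) parity phi (Ng g1 T))) => [|T /andP[_ /negPf->]//].
      by case: (parity _ L); case: (phi _); case: (\big[_/_]_(_ in _ | _) _).
    - by move=> T v TP; case: eqP => [->|_]; [exact: bL | have [] := NgP g1 T g1P' TP].
    - move=> T TP; case: eqP => [->|_]; last by rewrite addn0 sNg.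
      by rewrite cS; move: sL; move: (size L) #|S|./2 => a b; clear; lia.
    - by rewrite (bigD1 S) //= eqxx big1 // => T /andP[_ /negPf->].
  by move=> L L' bL bL' sL sL'; rewrite (swap L) // (swap L').
have [pi piP] := fin_all_exists chpi.
(* The potentials of the disjoint sets are glued together; on [B] the result is [pi set0]. *)
pose Pi v := pi (pblock P v) v; pose D := defect inc phi Pi.
have D0 e S : S \in P -> [set v | inc v e] \subset S -> D e = false.
  move=> SP eS; apply/negbTE; have := piP S SP e eS; congr (~~ _).
  rewrite /D /defect; congr (_ (+) _); apply: eq_bigr => v ve.
  by rewrite /Pi (def_pblock tP SP) //; apply: (subsetP eS); rewrite inE.
have parDN (g : {set V} -> E) S : (forall S, S \in P -> (g S \in cut inc B) /\ p (g S) = S) ->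
    S \in P -> parity D (Ng g S) = false.
  move=> gP SP; have [bN sN] := NgP g S gP SP; have ct := count_tight inc2 bN sN.
  rewrite /parity (@eq_in_count _ _ pred0) ?count_pred0 // => e eN /=.
  apply: (D0 e S SP); apply/subsetP=> v; rewrite inE => ve.
  have : 0 < count (inc v) (Ng g S) by rewrite -has_count; apply/hasP; exists e.
  by rewrite ct inE; case: (v \in S); rewrite ?andbF.
have parD L : (forall v, bd L v) -> parity D L = parity phi L (+) \big[addb/false]_v Pi v.
  by move=> bL; rewrite parity_defect; congr (_ (+) _); apply: eq_bigr => v _; rewrite bL andbT.
have DE (g : {set V} -> E) : (forall S, S \in P -> (g S \in cut inc B) /\ p (g S) = S) ->
    {in P &, injective (inn \o g)} ->
    \big[addb/false]_(S in P) D (g S) = ~~ parity D (enum E).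
  move=> gP gI; transitivity (parity D (assemble P g (Ng g))).
    by rewrite par_asm; apply: eq_bigr => S SP; rewrite parDN // addbF.
  rewrite parD ?(parD (enum E)) ?wrong_g ?addNb //; first by move=> v; rewrite odd_degree_enum.
  move=> v; rewrite (@odd_degree_assemble _ _ _ inc2 setT B P (inn \o g) g (out \o g)) ?inE ?subsetT //.
  - by move=> S SP; have [gB _] := gP S SP; have [] := end_inP v0 gB.
  - move=> S SP; have [gB _] := gP S SP; have [ie iB] := end_inP v0 gB.
    by have [oe oB] := end_outP v0 gB; split=> //; apply: outS.
  - by move=> S u SP; have [] := NgP g S gP SP.
(* All three edges at a vertex of [B] are in [cut B], so any other edge lies inside one set of [P],
   where [D] vanishes. *)
have parDE : parity D (enum E) = \big[addb/false]_(e in cut inc B) D e.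
  rewrite parity_big big_enum (bigID (mem (cut inc B))) /= [X in _ (+) X]big1 ?addbF // => e eB.
  have endB v : inc v e -> v \notin B.
    move=> ve; apply: contra eB => vB; have [_ _ /(_ v vB) fib] := reg3.
    have sub : [set e in cut inc B | inn e == v] \subset [set e | inc v e].
      apply/subsetP=> e'; rewrite in_set inE => /andP[eB /eqP<-].
      by have [] := end_inP v0 eB.
    have /eqP/setP/(_ e) : [set e in cut inc B | inn e == v] == [set e | inc v e].
      by rewrite eqEcard sub inc3 fib.
    by rewrite !in_set ve => /andP[].
  have [a ae] := inc_exists inc2 e.
  have aC : a \in cover P by rewrite covB inE endB.
  apply: (D0 e (pblock P a)); first exact: pblock_mem.
  apply/subsetP=> v; rewrite inE => ve.
  have /closed_inP := clP _ (pblock_mem aC); apply; [ | | exact: ae | exact: ve].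
    by rewrite mem_pblock.
  by rewrite !inE endB.
have peel (g : {set V} -> E) (E0 : {set E}) : (forall S, S \in P -> g S \in E0) ->
    {in P &, injective g} ->
    \big[addb/false]_(e in E0) D e =
    \big[addb/false]_(S in P) D (g S) (+) \big[addb/false]_(e in E0 :\: [set g S | S in P]) D e.
  move=> gE gI; rewrite (bigID (mem [set g S | S in P])) /=; congr (_ (+) _).
    rewrite -(big_imset D gI); apply: eq_bigl => e; apply: andb_idl => /imsetP[S SP ->].
    exact: gE.
  by apply: eq_bigl => e; rewrite in_setD andbC.
have injg (g : {set V} -> E) : {in P &, injective (inn \o g)} -> {in P &, injective g}.
  by move=> gI S T SP TP gST; apply: gI; rewrite //= gST.
have rest0 e : e \in cut inc B :\: [set g1 S | S in P] :\: [set g2 S | S in P] :\: [set g3 S | S in P] -> False.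
  have [eP fP _] := reg0 => eR; have /andP[pP _] := eP e eR.
  by have /eqP := fP _ pP; rewrite cards_eq0 => /eqP/setP/(_ e); rewrite in_set eR eqxx in_set0.
have E1 := peel g1 _ (fun S SP => proj1 (g1P S SP)) (injg g1 g1I).
have E2 := peel g2 _ (fun S SP => proj1 (g2P S SP)) (injg g2 g2I).
have E3 := peel g3 _ (fun S SP => proj1 (g3P S SP)) (injg g3 g3I).
(* Three copies of [~~ parity D (enum E)] add up to that same bit, which thus equals its
   complement. *)
move: parDE; rewrite E1 E2 E3 (DE g1 g1P' g1I) (DE g2 g2P' g2I) (DE g3 g3P' g3I).
by rewrite big1 => [|e /rest0//]; case: (parity D _).
Qed.

End Cubic.

(** * Cuts in a surface of Euler characteristic 1 *)

Section LinearAlgebra.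
Import GRing.Theory.
Local Open Scope ring_scope.

(** [bool] is the field with two elements, so these vectors are subsets of [I] under symmetric
    difference. *)
Definition F2vec (I : finType) : vectType bool := {ffun I -> bool^o}.

Section Vec.
Variable I : finType.
Definition unitv (i : I) : F2vec I := [ffun j => (j == i)].

Lemma dimF2 : \dim {: F2vec I} = #|I|.
Proof. by rewrite dimvf /dim /= muln1. Qed.

Lemma F2vec_sum (z : F2vec I) : z = \sum_i (z i : bool) *: unitv i.
Proof.
apply/ffunP=> j; rewrite sum_ffunE (bigD1 j) //= !ffunE eqxx big1 ?addr0 => [|i ij].
  by case: (z j).
by rewrite !ffunE eq_sym (negPf ij); case: (z i).
Qed.

End Vec.

(** Unless [W] is [U], it is the sum of [U] and a line [<[h]>]. The functional is a coordinate,
    nonzero at [h], of a projection with kernel [U], and [phi] lists its values on the unit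
    vectors. *)
Lemma codim1_functional (E : finType) (U W : {vspace F2vec E}) :
    (U <= W)%VS -> (\dim W <= (\dim U).+1)%N ->
  exists phi : E -> bool, forall z : F2vec E, z \in W ->
    \big[addb/false]_e ((z e : bool) && phi e) = false -> z \in U.
Proof.
move=> sUW dimW; have [WU|/subvPn[h hW hU]] := boolP (W <= U)%VS.
  by exists (fun=> false) => z zW _; apply: (subvP WU).
pose rho := (\1 - projv U)%VF.
have rhoU u : u \in U -> rho u = 0.
  by move=> uU; rewrite add_lfunE opp_lfunE id_lfunE projv_id // subrr.
have rho_h : rho h != 0.
  apply: contra hU; rewrite add_lfunE opp_lfunE id_lfunE subr_eq0 => /eqP->.
  exact: memv_proj.
have [e0 he0] : exists e, rho h e != 0.
  apply/existsP; apply: contraR rho_h => /existsPn h0; apply/eqP/ffunP=> e.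
  by rewrite ffunE; apply/eqP; have := h0 e; rewrite negbK.
exists (fun e => rho (unitv e) e0) => z zW.
have -> : \big[addb/false]_e ((z e : bool) && (rho (unitv e) e0 : bool)) = rho z e0.
  rewrite [in RHS](F2vec_sum z) linear_sum sum_ffunE; apply: eq_bigr => e _.
  by rewrite linearZ ffunE.
have WE : (U + <[h]>)%VS = W.
  apply/eqP; rewrite eqEdim subv_add sUW -memvE hW; apply: leq_trans dimW _.
  rewrite ltn_neqAle dimvS ?addvSl // andbT; apply: contra hU => /eqP dimE.
  have /eqP-> : U == (U + <[h]>)%VS by rewrite eqEdim addvSl -dimE leqnn.
  by rewrite memvE addvSr.
move: zW; rewrite -WE => /memv_addP[u uU [_ /vlineP[k ->] ->]].
rewrite linearD linearZ /= rhoU // add0r ffunE.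
case: k => [|_]; last by rewrite scale0r addr0.
by move/eqP; rewrite scale1r (negPf he0).
Qed.

Section Incidence.
Variables (I J : finType) (r : I -> J -> bool).

Definition incidence_map (h : F2vec J) : F2vec I := [ffun i => \big[addb/false]_j (r i j && (h j : bool))].

Lemma incidence_map_is_linear : linear incidence_map.
Proof.
move=> k u w; apply/ffunP=> i; case: k; last by rewrite !scale0r !add0r.
rewrite !scale1r !ffunE -[RHS]big_split; apply: eq_bigr => j _; rewrite !ffunE.
by case: (r i j); case: (u j); case: (w j).
Qed.

HB.instance Definition _ :=
  GRing.isLinear.Build bool (F2vec J) (F2vec I) *:%R incidence_map incidence_map_is_linear.

End Incidence.

Section Surface.
Variables (T V E : finType) (vinc : T -> E -> bool) (inc : V -> E -> bool).
Hypothesis vinc2 : forall e, #|[set x | vinc x e]| = 2.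
Hypothesis inc2 : forall e, #|[set v | inc v e]| = 2.
Hypothesis evenTV : forall x v, ~~ odd #|[set e | inc v e && vinc x e]|.
Hypothesis connT : forall A : {set T}, cut vinc A = set0 -> A = set0 \/ A = setT.
Hypothesis connV : forall A : {set V}, cut inc A = set0 -> A = set0 \/ A = setT.
Hypothesis euler : (#|T| + #|V| = #|E| + 1)%N.

(** [d] is the boundary in the dual graph and [dT] sends a vertex set to its cut. Connectedness
    gives [lker dT] dimension at most 1 and [limg d] codimension at most 1; by rank-nullity and
    [euler], the cuts have codimension at most 1 in [lker d]. *)
Lemma small_class_functional (v0 : V) : exists phi : E -> bool, forall H : {set E},
    (forall v, ~~ odd #|[set e in H | inc v e]|) -> ~~ odd #|[set e in H | phi e]| ->
  exists c : T -> bool, forall e x y, e \in H -> vinc x e -> vinc y e -> x != y -> c x != c y.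
Proof.
pose d := linfun (incidence_map inc); pose dT := linfun (incidence_map (fun e x => vinc x e)).
have dE h : d h = incidence_map inc h by rewrite lfunE.
have dTE h : dT h = incidence_map (fun e x => vinc x e) h by rewrite lfunE.
have dTx (c : F2vec T) e x y : vinc x e -> vinc y e -> x != y -> dT c e = (c x : bool) (+) (c y : bool).
  move=> xe ye xy; rewrite dTE ffunE (bigD1 x) //= xe (bigD1 y) ?ye 1?eq_sym //= big1 ?addbF //.
  move=> z /andP[zx zy]; rewrite (incE vinc2 z xe ye xy) (negPf zx).
  by rewrite (negPf zy).
(* By [evenTV], the cut around a single vertex of [T] meets every face evenly. *)
have sub : (limg dT <= lker d)%VS.
  apply/subvP=> _ /memv_imgP[c _ ->]; rewrite memv_ker dE dTE; apply/eqP/ffunP=> v.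
  rewrite !ffunE (eq_bigr (fun e => \big[addb/false]_x ((inc v e && vinc x e) && (c x : bool)))).
    rewrite exchange_big big1 // => x _.
    by rewrite -big_distrl /= xor_card (negPf (evenTV x v)).
  by move=> e _; rewrite ffunE big_distrr; apply: eq_bigr => x _; rewrite /= andbA.
have dim_ker : (\dim (lker d) <= (\dim (limg dT)).+1)%N.
  have kerT : (\dim (lker dT) <= 1)%N.
    pose one : F2vec T := [ffun=> true].
    apply: leq_trans (_ : \dim <[one]> <= 1)%N; last by rewrite dim_vline; case: eqP.
    apply/dimvS/subvP=> c; rewrite memv_ker => /eqP c0.
    have : cut vinc [set x | (c x : bool)] = set0.
      apply/setP=> e; rewrite in_set0; apply/negP=> /cutP[x [y []]]; rewrite !inE => cx cy xe ye.
      have xy : x != y by apply: contraNneq cy => <-.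
      by have := dTx c e x y xe ye xy; rewrite c0 ffunE cx (negPf cy).
    case/connT=> cE; [have -> : c = 0 | have -> : c = one]; rewrite ?mem0v ?memv_line //.
      by apply/ffunP=> x; have /setP/(_ x) := cE; rewrite !inE ffunE.
    by apply/ffunP=> x; have /setP/(_ x) := cE; rewrite !inE ffunE.
  have imV : (#|V| <= (\dim (limg d)).+1)%N.
    (* The unit vectors of the two ends of an edge differ by an element of [limg d]; by
       connectedness all of them are reached from [v0]. *)
    have full : (limg d + <[unitv v0]> = fullv)%VS.
      apply/eqP; rewrite eqEsubv subvf; apply/subvP=> g _; rewrite (F2vec_sum g).
      apply: memv_suml => v _; apply: memvZ.
      pose A := [set v | unitv v \in (limg d + <[unitv v0]>)%VS].
      have v0A : v0 \in A by rewrite inE; apply: subvP (addvSr _ _) _ (memv_line _).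
      suff : v \in A by rewrite inE.
      have [|A0|->] := connV (A := A); rewrite ?inE //; last by rewrite A0 inE in v0A.
      apply/setP=> e; rewrite in_set0; apply/negP=> /cutP[a [b [aA bA ae be]]].
      have ab : a != b by apply: contraNneq bA => <-.
      move: bA aA; rewrite !inE => /negP bA aA; apply: bA.
      have -> : unitv b = d (unitv e) + unitv a.
        apply/ffunP=> w; rewrite dE !ffunE (bigD1 e) //= big1 ?addr0; last first.
          by move=> e' ne; rewrite ffunE (negPf ne) andbF.
        rewrite ffunE eqxx andbT (incX inc2 w ae be ab).
        by case: (w == a); case: (w == b).
      by rewrite memvD // (subvP (addvSl _ _)) // memv_img ?memvf.
    rewrite -dimF2 -full; apply: leq_trans (dimv_add_leqif _ _) _.
    by rewrite -addn1 leq_add2l dim_vline; case: eqP.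
  have := limg_ker_dim d fullv; have := limg_ker_dim dT fullv; rewrite !capfv !dimF2.
  by move: euler kerT imV; clear; lia.
have [phi phiP] := codim1_functional sub dim_ker; exists phi => H evH parH.
pose z : F2vec E := [ffun e => e \in H].
have [||c _ zc] := memv_imgP (phiP z _ _).
- rewrite memv_ker dE; apply/eqP/ffunP=> v; rewrite !ffunE xor_card.
  rewrite -[RHS](negPf (evH v)); congr (odd #|pred_of_set _|).
  by apply/setP=> e; rewrite !inE ffunE andbC.
- rewrite -[RHS](negPf parH) xor_card; congr (odd #|pred_of_set _|).
  by apply/setP=> e; rewrite !inE ffunE.
exists c => e x y eH xe ye xy; have := dTx c e x y xe ye xy.
by rewrite -zc ffunE eH; case: (c x); case: (c y).
Qed.

End Surface.

End LinearAlgebra.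

Lemma card_sig_pred (X : finType) (A : {set X}) (P : pred X) :
  #|[set u : {x | x \in A} | P (val u)]| = #|[set x in A | P x]|.
Proof.
rewrite -(card_imset _ val_inj); congr #|pred_of_set _|; apply/setP=> x; rewrite inE.
apply/imsetP/andP => [[u + ->]|[xA Px]]; first by rewrite inE (valP u).
by exists (exist _ x xA); rewrite ?inE.
Qed.

(** * Triangulations *)

Section Triangulation.
Variables (T : finType) (e : rel T) (F : {set {set T}}).
Hypothesis triF : surface_triangulation e F.

Local Notation face := {f : {set T} | f \in F}.
Local Notation edge := {s : {set T} | s \in edges e}.

(** The incidence of the dual graph; with [on_edge], the graph and its dual share one type of
    edges. *)
Definition on_face (f : face) (s : edge) := val s \subset val f.
Definition on_edge (x : T) (s : edge) := x \in val s.

Lemma adj_neq x y : e x y -> x != y.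
Proof.
by case: triF => -[[irr _] _] _ _ _ _; apply: contraTneq => ->; rewrite irr.
Qed.

Lemma mem_edges s : reflect (exists x y, e x y /\ s = [set x; y]) (s \in edges e).
Proof.
rewrite inE; apply: (iffP existsP) => [[x /existsP[y /andP[exy /eqP->]]]|[x [y [exy ->]]]].
  by exists x, y.
by exists x; apply/existsP; exists y; rewrite exy eqxx.
Qed.

Lemma edge_pair x y : e x y -> exists s : edge, val s = [set x; y].
Proof.
move=> exy; have sE : [set x; y] \in edges e by apply/mem_edges; exists x, y.
by exists (exist (fun s => s \in edges e) _ sE).
Qed.

Lemma card_face f : f \in F -> #|f| = 3.
Proof. by case: triF => _ /(_ f) h _ _ _ /h[]. Qed.

Lemma face_adj f x y : f \in F -> x \in f -> y \in f -> x != y -> e x y.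
Proof. by case: triF => _ /(_ f) h _ _ _ /h[_]; apply. Qed.

Lemma face_edge f s : f \in F -> (s \in edges e) && (s \subset f) = (s \subset f) && (#|s| == 2).
Proof.
move=> fF; rewrite andbC; case: (boolP (s \subset f)) => //= sf.
apply/mem_edges/cards2P => -[x [y [xy sE]]]; exists x, y; split=> //.
  exact: adj_neq.
by move: sf; rewrite sE subUset !sub1set => /andP[xf yf]; apply: face_adj fF xf yf xy.
Qed.

Lemma on_edge2 s : #|[set x | on_edge x s]| = 2.
Proof.
have [x [y [exy sE]]] := mem_edges _ (valP s); rewrite /on_edge sE.
by rewrite -[RHS]/(true.+1) -(adj_neq exy) -cards2; congr #|pred_of_set _|; apply/setP=> z; rewrite inE.
Qed.

Lemma on_face2 s : #|[set f | on_face f s]| = 2.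
Proof.
have [x [y [exy sE]]] := mem_edges _ (valP s); rewrite /on_face sE.
rewrite (card_sig_pred F (fun f => [set x; y] \subset f)).
case: triF => _ _ /(_ x y exy) <- _ _; congr #|pred_of_set _|; apply/setP=> f.
by rewrite !inE subUset !sub1set.
Qed.

Lemma on_face3 f : #|[set s | on_face f s]| = 3.
Proof.
rewrite /on_face (card_sig_pred (edges e) (fun s => s \subset val f)).
rewrite -[RHS]/('C(3, 2)) -(card_face (valP f)) -cards_draws.
by congr #|pred_of_set _|; apply/setP=> s; rewrite in_set face_edge ?(valP f) // !inE.
Qed.

(** Of the three edges of a face, exactly one avoids a given vertex of it. *)
Lemma face_vertex_even x f : ~~ odd #|[set s | on_face f s && on_edge x s]|.
Proof.
rewrite /on_face /on_edge (card_sig_pred (edges e) (fun s => (s \subset val f) && (x \in s))).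
have -> : [set s in edges e | (s \subset val f) && (x \in s)]
        = [set s : {set T} | (s \subset val f) && (#|s| == 2) & x \in s].
  by apply/setP=> s; rewrite in_set andbA face_edge ?(valP f) // !inE.
set D := [set s : {set T} | s \subset val f & #|s| == 2].
have cD : #|D| = 3 by rewrite cards_draws (card_face (valP f)).
have [xf|xf] := boolP (x \in val f); last first.
  suff -> : [set s : {set T} | (s \subset val f) && (#|s| == 2) & x \in s] = set0.
    by rewrite cards0.
  by apply/setP=> s; rewrite !inE; apply/negP=> /andP[/andP[/subsetP sf _] /sf]; rewrite (negPf xf).
have cDx : #|[set s : {set T} | s \subset val f :\ x & #|s| == 2]| = 1.
  rewrite cards_draws; have := card_face (valP f).
  by rewrite (cardsD1 x) xf add1n => -[->].
have := cardsID [set s : {set T} | x \in s] D; rewrite cD.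
have -> : D :\: [set s : {set T} | x \in s] = [set s : {set T} | s \subset val f :\ x & #|s| == 2].
  by apply/setP=> s; rewrite !inE subsetD1 andbA; case: (x \in s); rewrite ?andbF ?andbT.
rewrite cDx addn1 => -[]; suff -> : D :&: [set s : {set T} | x \in s]
  = [set s : {set T} | (s \subset val f) && (#|s| == 2) & x \in s] by move=> ->.
by apply/setP=> s; rewrite !inE.
Qed.

(** Let [x] be an end of the only cut edge [s0]. Every face of [S] has an even number of edges at
    [x], but their sum modulo 2 counts the cut edges at [x], that is, [s0] alone. *)
Lemma dual_bridgeless S : #|cut on_face S| != 1.
Proof.
apply/negP=> /cards1P[s0 cutE].
have [x xs0] := inc_exists on_edge2 s0.
have : \big[addb/false]_(f in S) \big[addb/false]_s (on_face f s && on_edge x s) = false.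
  by rewrite big1 // => f _; rewrite xor_card; apply/negbTE/face_vertex_even.
rewrite exchange_big /= (eq_bigr (fun s => (s \in cut on_face S) && on_edge x s)) => [|s _].
  rewrite cutE (bigD1 s0) //= inE eqxx xs0 big1 // => s ne.
  by rewrite inE (negPf ne).
rewrite -big_distrl /= -(odd_inc_cut on_face2); congr (_ && _).
by rewrite big_mkcond xor_card; congr (odd #|pred_of_set _|); apply/setP=> f; rewrite !inE; case: ifP.
Qed.

Lemma graph_connected (A : {set T}) : cut on_edge A = set0 -> A = set0 \/ A = setT.
Proof.
move=> cutA; have [->|[x xA]] := set_0Vmem A; [by left|right].
have cl : closed e (mem A).
  have half a b : e a b -> a \in A -> b \in A.
    move=> eab aA; apply: contraT => bA; have [s sE] := edge_pair eab.
    have : s \in cut on_edge A.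
      by apply/cutP; exists a, b; rewrite /on_edge sE !inE !eqxx orbT.
    by rewrite cutA inE.
  case: triF => -[[_ sym] _] _ _ _ _ a b eab.
  by apply/idP/idP; apply: half; rewrite // sym.
apply/setP=> y; rewrite inE; case: triF => _ _ _ _ /(_ x y) /(closed_connect cl) <-.
exact: xA.
Qed.

(** As links are connected, the faces at a vertex are all in [A] or all outside; connectedness of
    the graph carries this from vertex to vertex. *)
Lemma dual_connected (A : {set face}) : cut on_face A = set0 -> A = set0 \/ A = setT.
Proof.
move=> cutA; have [->|[f0 f0A]] := set_0Vmem A; [by left|right].
have sym : symmetric e by case: triF => -[[_ sym] _].
have share (f g : face) x y : e x y -> x \in val f -> y \in val f -> x \in val g -> y \in val g ->
    f \in A -> g \in A.
  move=> exy xf yf xg yg fA; apply: contraT => gA; have [s sE] := edge_pair exy.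
  have : s \in cut on_face A.
    by apply/cutP; exists f, g; rewrite /on_face sE !subUset !sub1set xf yf xg yg.
  by rewrite cutA inE.
(* The vertices sharing a face of [A] with [v]. A step in the link of [v] passes to a face across an
   edge at [v], so it stays in [A]. *)
pose near v := [pred u | [exists f in A, (v \in val f) && (u \in val f)]].
have near_link v : closed (link F v) (near v).
  have half u w : link F v u w -> u \in near v -> w \in near v.
    rewrite /link => vuwF /existsP[f /and3P[fA vf uf]].
    pose g : face := exist (fun f => f \in F) _ vuwF.
    have vu : v != u.
      apply/eqP=> E1; have := card_face vuwF; rewrite E1 setUid cards2.
      by case: eqP.
    apply/existsP; exists g; rewrite !inE !eqxx !orbT !andbT /=.
    apply: (share f g v u) => //; rewrite ?inE ?eqxx ?orbT //.
    exact: face_adj (valP f) _ _ vu.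
  have slink u w : link F v u w = link F v w u by rewrite /link setUAC.
  by move=> u w luw; apply/idP/idP; apply: half; rewrite // slink.
have third f v : f \in F -> v \in f -> exists2 u, u \in f & v != u.
  move=> fF vf; have /card_gt0P[u] : 0 < #|f :\ v|.
    by have := card_face fF; rewrite (cardsD1 v) vf add1n => -[->].
  by rewrite !inE eq_sym => /andP[uv uf]; exists u.
have star v (f g : face) : f \in A -> v \in val f -> v \in val g -> g \in A.
  move=> fA vf vg; have [u uf vu] := third _ v (valP f) vf.
  have [w wg vw] := third _ v (valP g) vg.
  have evu := face_adj (valP f) vf uf vu; have evw := face_adj (valP g) vg wg vw.
  have : w \in near v.
    case: triF => _ _ _ /(_ v u w evu evw)/(closed_connect (@near_link v)) <- _.
    by apply/existsP; exists f; rewrite fA vf uf.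
  case/existsP=> h /and3P[hA vh wh].
  exact: (share h g v w).
have balanced_in : forall v, v \in [set v | [exists f in A, v \in val f]].
  have [v0 v0f0] : exists v, v \in val f0.
    by apply/set0Pn; rewrite -cards_eq0 (card_face (valP f0)).
  set G := [set v | _].
  have cl : closed e (mem G).
    have half a b : e a b -> a \in G -> b \in G.
      rewrite !inE => eab /existsP[f /andP[fA af]].
      have [s sE] := edge_pair eab.
      have /card_gt0P[g] : 0 < #|[set g | on_face g s]| by rewrite on_face2.
      rewrite inE /on_face sE subUset !sub1set => /andP[ag bg].
      by apply/existsP; exists g; rewrite bg (star a f).
    by move=> a b eab; apply/idP/idP; apply: half; rewrite // sym.
  move=> v; case: triF => _ _ _ _ /(_ v0 v) /(closed_connect cl) <-.
  by rewrite inE; apply/existsP; exists f0; rewrite f0A.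
apply/setP=> g; rewrite inE.
have [v vg] : exists v, v \in val g.
  by apply/set0Pn; rewrite -cards_eq0 (card_face (valP g)).
have := balanced_in v; rewrite inE => /existsP[f /andP[fA vf]].
exact: star fA vf vg.
Qed.

End Triangulation.

(** From [2 * #|J| <= #|F| + 2] and [3 * #|F| = 2 * #|edges e|], at most a third of the edges plus
    one are removed. *)
Theorem theorem1p8 (T : finType) (e : rel T) (F : {set {set T}}) :
  projective_plane_triangulation e F ->
  exists H : {set {set T}},
    [/\ H \subset edges e, bipartite_edges H &
        (2 * #|edges e| <= 3 * #|H| + 3)%N].
Proof.
move=> [triF euler].
have [f0 f0F] : exists f, f \in F by case: (triF) => -[_ /set0Pn].
pose v0 : {f : {set T} | f \in F} := exist _ f0 f0F.
have eulerT : #|T| + #|{: {f : {set T} | f \in F}}| = #|{: {s : {set T} | s \in edges e}}| + 1.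
  by rewrite !card_sig euler.
have [phi phiP] := small_class_functional (on_edge2 triF) (on_face2 triF)
  (face_vertex_even triF) (graph_connected triF) (dual_connected triF) eulerT v0.
have [L [bL sL pL]] := cubic_small_join (on_face2 triF) (on_face3 triF)
  (dual_bridgeless triF) v0 phi.
pose J := [set s | odd (count_mem s L)].
(* Complementing [J] turns its odd degrees at the faces into even ones, and its [phi] parity, which
   is that of all edges, into zero. *)
have oddC (a : pred {s : {set T} | s \in edges e}) : odd #|[set s in ~: J | a s]| = odd #|[set s | a s]| (+) parity a L.
  rewrite parity_odd_set -/J -(cardsID J [set s | a s]) oddD.
  have -> : [set s | a s] :&: J = [set s in J | a s] by apply/setP=> s; rewrite !inE andbC.
  have -> : [set s | a s] :\: J = [set s in ~: J | a s] by apply/setP=> s; rewrite !inE.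
  by rewrite addbC addKb.
have [|| c cP] := phiP (~: J).
- by move=> f; rewrite oddC on_face3 // [parity _ _]bL.
- by rewrite oddC pL /parity count_enumT addbb.
have cJ : 2 * #|J| <= #|F| + 2.
  apply: leq_trans (_ : 2 * size L <= _); first by rewrite leq_mul2l card_odd_set.
  by move: sL; rewrite card_sig.
have c32 : 3 * #|F| = 2 * #|edges e|.
  have := handshake (on_face2 triF) (enum {: {s : {set T} | s \in edges e}}).
  rewrite -cardE card_sig => <-.
  rewrite (eq_bigr (fun=> 3)) => [|f _]; last by rewrite count_enumT on_face3.
  by rewrite sum_nat_const card_sig mulnC.
exists [set val s | s in ~: J]; split.
- by apply/subsetP=> _ /imsetP[s _ ->]; apply: valP.
- exists c => x y /imsetP[s sJ sE]; have xs : on_edge x s by rewrite /on_edge -sE !inE eqxx.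
  have ys : on_edge y s by rewrite /on_edge -sE !inE eqxx orbT.
  apply: cP sJ xs ys _; apply/eqP=> E1; have := on_edge2 triF s.
  suff -> : [set z | on_edge z s] = [set x; y] by rewrite E1 setUid cards1.
  by apply/setP=> z; rewrite sE inE.
- rewrite card_imset; last exact: val_inj.
  have := cardsC J; rewrite card_sig; move: c32 cJ.
  by move: #|J| #|F| #|edges e| #|~: J| => a b k d; clear; lia.
Qed.
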